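(* Let $\widetilde{W}/W\in\{\widetilde{C}_n/C_n,\widetilde{B}_n/B_n,\widetilde{B}_n/D_n,\widetilde{D}_n/D_n\}$ and let $a=\mathcal{A}(w)$ be the abacus corresponding to a minimal length coset representative $w\in\widetilde{W}/W$. For $1\le i\le n$, let $B(i)$ be the lowest bead occurring in either runner $i$ or runner $N-i$, and let $b(i)$ be the bead with $n+1\le b(i)\le N+n$ occurring in $B(i)$'s runner. Let $g_i$ be the number of gaps between $B(i)$ and $b(i)$ in $a$. Then $$\ell(w)=\sum_{1\le i\le n}g_i+(1+x_0+x_n)\cdot\big(\text{number of beads of }a\text{ that are}>N+n\big)+\sum_{\substack{b\text{ a bead of }a\\ N+1\le b\le N+n}}(b-N+x_0).$$
   Context: Offsets: $x_0=0$ in types $\widetilde{C}/C,\widetilde{B}/D$ and $x_0=-1$ in types $\widetilde{B}/B,\widetilde{D}/D$; $x_n=0$ in types $\widetilde{C}/C,\widetilde{B}/B$ and $x_n=-1$ in types $\widetilde{B}/D,\widetilde{D}/D$. Groups. Let $N=2n+1$. A mirrored $\mathbb{Z}$-permutation is a bijection $w:\mathbb{Z}\to\mathbb{Z}$ with $w(i+N)=w(i)+N$ and $w(-i)=-w(i)$ for all $i\in\mathbb{Z}$; it is determined by $(w(1),\dots,w(n))$. Under composition these form the affine Coxeter group $\widetilde{C}_n$. Define elements by their images $(w(1),\dots,w(n))$: $s_i=(1,\dots,i-1,i+1,i,i+2,\dots,n)$ for $1\le i\le n-1$; $s_0^C=(-1,2,3,\dots,n)$; $s_0^D=(-2,-1,3,\dots,n)$;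 $s_n^C=(1,\dots,n-1,n+1)$; $s_n^D=(1,\dots,n-2,n+1,n+2)$. The four types are: - $\widetilde{C}/C$: $\widetilde{W}$ is all mirrored $\mathbb{Z}$-permutations, generators $s_0=s_0^C,s_1,\dots,s_{n-1},s_n=s_n^C$ ($n\ge2$). - $\widetilde{B}/B$: those with $|\{i\le0:w(i)\ge1\}|$ even, generators $s_0=s_0^D,s_1,\dots,s_{n-1},s_n=s_n^C$ ($n\ge3$). - $\widetilde{B}/D$: those with $|\{i\le n:w(i)\ge n+1\}|$ even, generators $s_0=s_0^C,s_1,\dots,s_{n-1},s_n=s_n^D$ ($n\ge3$). - $\widetilde{D}/D$: those satisfying both parity conditions, generators $s_0=s_0^D,s_1,\dots,s_{n-1},s_n=s_n^D$ ($n\ge4$). $W$ is generated by $s_1,\dots,s_n$, and $\widetilde{W}/W$ denotes the set of minimal length representatives of the cosets $wW$. $\ell$ is Coxeter length in $\widetilde{W}$ with respect to $s_0,\dots,s_n$. Abaci. An abacus has runners (columns) $1,\dots,2n$; runner $i$ has entries labeled $mN+i$ for each level $m\in\mathbb{Z}$ (so the entries are the integers not divisible by $N$); some entries are beads, the others gaps. Reading order is the order of the labels; ''lowest'' means largest label; ''between'' refers to reading order (over all runners). The abacus is flush if no bead is preceded by a gap on its runner. $\mathcal{A}(w)$ is the flush abacus whose lowest bead in each runner is an element of $\{w(1),\dots,w(2n)\}$. *)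

(* Defs.v *)
From mathcomp Require Import all_boot all_order all_algebra.
From mathcomp Require Import finmap.
From mathcomp Require Import boolp classical_sets functions cardinality fsbigop.
From mathcomp Require Import zify.

Set Implicit Arguments.
Unset Strict Implicit.
Unset Printing Implicit Defensive.
Import Order.TTheory GRing.Theory Num.Theory.

Local Open Scope classical_set_scope.
Local Open Scope ring_scope.

(** [fset_set] is empty on infinite sets; the sets counted below are all finite,
    a mirrored permutation being at bounded distance from the identity. *)
Definition card_set (A : set int) : nat := #|` fset_set A|%fset.

Definition is_max (A : set int) (m : int) : Prop :=
  A m /\ forall c, A c -> c <= m.

(** * The affine groups *)

Definition period (n : nat) : int := (n.*2.+1)%:Z.

Definition mirrored (n : nat) (w : int -> int) : Prop :=
  [/\ bijective w,
      forall i, w (i + period n) = w i + period n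
    & forall i, w (- i) = - w i].

(** The mirrored extension to [int] of the images of [1, ..., n]; on
    [n + 1, ..., 2n] mirroring forces [w r = N - w (N - r)]. *)
Definition mirror_ext (n : nat) (f : int -> int) (z : int) : int :=
  let N := period n in
  let q := (z %/ N)%Z in
  let r := (z %% N)%Z in
  if r == 0 then z
  else if r <= n%:Z then f r + q * N
  else N - f (N - r) + q * N.

Variant abacus_type : Set := typeCC | typeBB | typeBD | typeDD.

Definition x_first (t : abacus_type) : int :=
  match t with typeCC | typeBD => 0 | typeBB | typeDD => -1 end.

Definition x_last (t : abacus_type) : int :=
  match t with typeCC | typeBB => 0 | typeBD | typeDD => -1 end.

Definition min_rank (t : abacus_type) : nat :=
  match t with typeCC => 2 | typeBB | typeBD => 3 | typeDD => 4 end%N.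

Definition even_at_zero (w : int -> int) : Prop :=
  ~~ odd (card_set [set i : int | i <= 0 /\ 1 <= w i]).

Definition even_at_n (n : nat) (w : int -> int) : Prop :=
  ~~ odd (card_set [set i : int | i <= n%:Z /\ n%:Z + 1 <= w i]).

Definition affine_group (t : abacus_type) (n : nat) : set (int -> int) :=
  [set w | mirrored n w /\
    match t with
    | typeCC => True
    | typeBB => even_at_zero w
    | typeBD => even_at_n n w
    | typeDD => even_at_zero w /\ even_at_n n w
    end].

Definition s_mid (n : nat) (i : int) : int -> int :=
  mirror_ext n (fun k => if k == i then i + 1 else if k == i + 1 then i else k).

Definition s0C (n : nat) : int -> int :=
  mirror_ext n (fun k => if k == 1 then -1 else k).

Definition s0D (n : nat) : int -> int :=
  mirror_ext n (fun k => if k == 1 then -2 else if k == 2 then -1 else k).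

Definition snC (n : nat) : int -> int :=
  mirror_ext n (fun k => if k == n%:Z then n%:Z + 1 else k).

Definition snD (n : nat) : int -> int :=
  mirror_ext n (fun k => if k == n%:Z - 1 then n%:Z + 1
                         else if k == n%:Z then n%:Z + 2 else k).

Definition gen (t : abacus_type) (n : nat) (i : 'I_n.+1) : int -> int :=
  if i == 0%N :> nat then
    match t with typeCC | typeBD => s0C n | typeBB | typeDD => s0D n end
  else if i == n :> nat then
    match t with typeCC | typeBB => snC n | typeBD | typeDD => snD n end
  else s_mid n (i : nat)%:Z.

Definition eval_word (t : abacus_type) (n : nat) (s : seq 'I_n.+1) :
    int -> int :=
  foldr (fun i f => gen t i \o f) id s.

Definition word_sizes (t : abacus_type) (n : nat) (w : int -> int) : set nat :=
  [set k | exists2 s : seq 'I_n.+1, size s = k & eval_word t s = w].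

(** The least [k] in [word_sizes t n w]; the default is only reached when [w]
    is not a product of generators. *)
Definition coxeter_length (t : abacus_type) (n : nat) (w : int -> int) : nat :=
  xget 0%N [set k | word_sizes t n w k /\
                    forall m, word_sizes t n w m -> (k <= m)%N].

(** Inverses are not needed, the generators being involutions. *)
Definition parabolic (t : abacus_type) (n : nat) : set (int -> int) :=
  [set u | exists2 s : seq 'I_n.+1,
             all (fun i : 'I_n.+1 => i != 0%N :> nat) s & eval_word t s = u].

Definition min_coset_rep (t : abacus_type) (n : nat) : set (int -> int) :=
  [set w | affine_group t n w /\
    forall u, parabolic t n u ->
      (coxeter_length t n w <= coxeter_length t n (w \o u))%N].

(** * Abaci, represented by their sets of beads *)

Definition entries (n : nat) : set int := [set b | ~~ (period n %| b)%Z].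

Definition runner (n : nat) (i : int) : set int :=
  [set b | (b = i %[mod period n])%Z].

Definition is_abacus (n : nat) (a : set int) : Prop := a `<=` entries n.

Definition gaps (n : nat) (a : set int) : set int := entries n `\` a.

Definition flush (n : nat) (a : set int) : Prop :=
  forall b c, a b -> gaps n a c -> runner n b c -> ~ c < b.

Definition abacus_of (n : nat) (w : int -> int) (a : set int) : Prop :=
  [/\ is_abacus n a, flush n a &
      forall i : nat, (1 <= i <= n.*2)%N ->
        exists2 j : nat, (1 <= j <= n.*2)%N &
          is_max (a `&` runner n i%:Z) (w j%:Z)].

Definition lowest_bead (n : nat) (a : set int) (i : nat) : int :=
  xget 0 [set m | is_max (a `&` (runner n i%:Z `|` runner n (period n - i%:Z)))
                         m].

Definition window_bead (n : nat) (a : set int) (i : nat) : int :=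
  xget 0 [set b | [/\ a b, n%:Z + 1 <= b <= period n + n%:Z
                    & runner n (lowest_bead n a i) b]].

(** The bead [window_bead n a i] is at or above [lowest_bead n a i], which is
    the last bead of the same runner. *)
Definition gaps_between (n : nat) (a : set int) (i : nat) : nat :=
  card_set (gaps n a `&`
    [set g | window_bead n a i < g < lowest_bead n a i]).

Lemma period_small (n : nat) (q : int) :
  - period n < q * period n < period n -> q = 0.
Proof.
move=> /andP[h1 h2]; have [q1|q1|//] := ltrgtP q 0.
  have : q * period n <= - period n by rewrite /period; nia.
  by rewrite leNgt h1.
have : period n <= q * period n by rewrite /period; nia.
by rewrite leNgt h2.
Qed.

Section AbacusOfMirrored.
Variables (n : nat) (w : int -> int).
Hypothesis wP : mirrored n w.

Lemma mirrored_shift (i k : int) : w (i + k * period n) = w i + k * period n.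
Proof.
have [_ wN _] := wP.
have H (m : nat) j : w (j + m%:Z * period n) = w j + m%:Z * period n.
  elim: m j => [|m IHm] j; first by rewrite mul0r !addr0.
  by rewrite -addn1 PoszD mulrDl mul1r !addrA wN IHm.
case: (intP k) => [|m|m]; [exact: (H 0%N) | exact: H |].
by have := H m.+1 (i + - m.+1%:Z * period n); rewrite -addrA mulNr addNr addr0; lia.
Qed.

Lemma mirrored0 : w 0 = 0.
Proof. by have [_ _ /(_ 0)] := wP; rewrite oppr0; move: (w 0) => x; lia. Qed.

Lemma mirrored_residue_inj (j k : nat) :
  (1 <= j <= n.*2)%N -> (1 <= k <= n.*2)%N ->
  (w j%:Z = w k%:Z %[mod period n])%Z -> j = k.
Proof.
move=> hj hk /eqP; rewrite eqz_mod_dvd => /dvdzP[q Hq].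
have [/bij_inj winj _ _] := wP.
have /winj : w j%:Z = w (k%:Z + q * period n) by rewrite mirrored_shift -Hq addrC subrK.
move=> E; have : q = 0 by apply: (@period_small n); move: E; rewrite /period; lia.
by move=> q0; move: E; rewrite q0; lia.
Qed.

Lemma mirrored_residue_surj (z : int) : entries n z ->
  exists2 j : nat, (1 <= j <= n.*2)%N & (w j%:Z = z %[mod period n])%Z.
Proof.
move=> hz; have [[v _ vK] _ _] := wP.
have Np : period n != 0 by rewrite /period; lia.
have E := divz_eq (v z) (period n).
have r0 := modz_ge0 (v z) Np.
have rN : ((v z) %% period n)%Z < period n by apply: ltz_pmod; rewrite /period; lia.
have Hz : z = w (v z %% period n)%Z + (v z %/ period n)%Z * period n.
  by rewrite -mirrored_shift addrC -E vK.
case: (v z %% period n)%Z r0 rN Hz => [j|//] _ rN Hz.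
exists j; last by rewrite Hz addrC modzMDl.
rewrite lt0n; apply/andP; split; last by move: rN; rewrite /period; lia.
apply: contraNneq (hz) => j0.
by rewrite Hz j0 mirrored0 add0r dvdz_mull.
Qed.

Lemma mirrored_entry (j : nat) : (1 <= j <= n.*2)%N -> entries n (w j%:Z).
Proof.
move=> hj; apply/negP => /dvdzP[q Hq]; have [/bij_inj winj _ _] := wP.
have /winj : w j%:Z = w (0 + q * period n).
  by rewrite mirrored_shift mirrored0 add0r.
move=> E; have q0 : q = 0 by apply: (@period_small n); move: E; rewrite /period; lia.
by move: E; rewrite q0; lia.
Qed.

(** Every mirrored permutation has exactly one abacus. *)
Lemma abacus_ofP (a : set int) :
  abacus_of n w a <->
  a = [set b | exists2 j : nat, (1 <= j <= n.*2)%N &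
                 runner n (w j%:Z) b /\ b <= w j%:Z].
Proof.
have ent_mod b c : (b = c %[mod period n])%Z -> entries n b -> entries n c.
  move=> e; apply: contra => /dvdz_mod0P c0.
  by apply/dvdz_mod0P; rewrite e.
have repr_run b : entries n b ->
    exists2 i : nat, (1 <= i <= n.*2)%N & (b = i%:Z %[mod period n])%Z.
  move=> bE; have Np : period n != 0 by rewrite /period; lia.
  have r0 := modz_ge0 b Np.
  have rN : (b %% period n)%Z < period n by apply: ltz_pmod; rewrite /period; lia.
  have Hz := modz_mod b (period n).
  case E : (b %% period n)%Z r0 rN Hz => [j|//] _ rN Hz.
  exists j; last by rewrite Hz.
  rewrite lt0n; apply/andP; split; last by move: rN; rewrite /period; lia.
  by apply: contraNneq (bE) => j0; apply/dvdz_mod0P; rewrite E j0.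
split=> [[aE aF aM]|->].
  apply/seteqP; split=> b /=.
    move=> ab; have [i hi ei] := repr_run _ (aE _ ab).
    have [j hj [[_ wj] jmax]] := aM i hi.
    exists j => //; split; first by rewrite /runner /= ei -wj.
    exact: jmax.
  move=> [j hj [bj lbj]].
  have bE : entries n b by apply: ent_mod (mirrored_entry hj); rewrite bj.
  have [i hi ei] := repr_run _ bE.
  have [k hk [[awk wk] kmax]] := aM i hi.
  have jk : j = k.
    by apply: mirrored_residue_inj => //; rewrite wk -ei; exact: esym.
  subst k; apply: contrapT => nab.
  move: lbj; rewrite le_eqVlt => /predU1P[E|lt]; first by rewrite E in nab.
  by apply: (aF (w j%:Z) b).
split.
- move=> b [j hj [bj _]].
  by apply: ent_mod (mirrored_entry hj); rewrite bj.
- move=> b c [j hj [bj lbj]] [_ nc] cb lt; apply: nc; exists j => //; split.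
    by rewrite /runner /= cb.
  exact: le_trans (ltW lt) lbj.
- move=> i hi; have iE : entries n i%:Z.
    apply/negP => /dvdzP[q E].
    have q0 : q = 0 by apply: (@period_small n); move: E; rewrite /period; lia.
    by move: E; rewrite q0; lia.
  have [j hj ej] := mirrored_residue_surj iE.
  exists j => //; split; first by split=> //; exists j.
  move=> c [[k hk [ck lck]] ci].
  suff -> : j = k by [].
  by apply: mirrored_residue_inj => //; rewrite ej -ci ck.
Qed.

End AbacusOfMirrored.

(* Main.v *)
(* The quantities |floor((w j - w i)/N)|, |floor((w i + w j)/N)|, |floor(w i/N)| and
   |floor((w i + n)/N)|, for 1 <= i < j <= n, count the inversions of [w] that
   belong to the various classes of reflections, and right multiplication by a
   generator permutes them except for one, which changes by one; when x_0 = -1 (resp.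
   x_n = -1) the third (resp. fourth) family is left out, and its sum has the
   parity that the group prescribes.  An element without descents is then the
   identity, so the total is the Coxeter length.  For a minimal coset
   representative, c_i = max (w i, N - w i) is decreasing in i and lists the
   beads B(.).  Write c_i = b_i + h_i N with n + 1 <= b_i <= N + n.  The gaps
   between b_j and c_j number n h_j + sum_(i > j) floor((c_j - c_i)/N), there
   are sum_i h_i beads beyond N + n, and the |b_i - N| are a permutation of
   1, ..., n: hence floor((b_i + b_j)/N) - 1 is 1 or 0 according to whether the
   larger of |b_i - N| and |b_j - N| has its b beyond N, and the sum over pairs
   of these numbers is the sum of b - N - 1 over the b_i beyond N. *)
Require Import Defs.
From mathcomp Require Import all_boot all_order all_algebra.
From mathcomp Require Import perm.
From mathcomp Require Import finmap.
From mathcomp Require Import boolp classical_sets functions cardinality fsbigop.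
From mathcomp Require Import zify.

Set Implicit Arguments.
Unset Strict Implicit.
Unset Printing Implicit Defensive.
Import Order.TTheory GRing.Theory Num.Theory.
Local Open Scope classical_set_scope.
Local Open Scope ring_scope.

(** * Inversion statistics of a window *)

Section Floor.
Variable n : nat.
Local Notation N := (period n).

Lemma period_gt0 : 0 < N. Proof. by rewrite /period; lia. Qed.

Lemma periodE : N = n%:Z + n%:Z + 1. Proof. by rewrite /period; lia. Qed.

Definition flo (x : int) : int := (x %/ N)%Z.

Lemma floP x : flo x * N <= x < flo x * N + N.
Proof.
have := modz_ge0 x (lt0r_neq0 period_gt0); have := ltz_pmod x period_gt0.
by have := divz_eq x N; rewrite /flo; lia.
Qed.

Lemma flo_unique x q : q * N <= x < q * N + N -> flo x = q.
Proof.
move=> h; have := floP x; have := period_gt0.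
by move: (flo x) => f; nia.
Qed.

Lemma flo_small x : 0 <= x < N -> flo x = 0.
Proof. by move=> h; apply: flo_unique; rewrite mul0r add0r. Qed.

Lemma floDM x k : flo (x + k * N) = flo x + k.
Proof. by apply: flo_unique; have := floP x; rewrite mulrDl; lia. Qed.

Lemma floDN x : flo (x + N) = flo x + 1.
Proof. by rewrite -(floDM x 1) mul1r. Qed.

Lemma floN x : ~~ (N %| x)%Z -> flo (- x) = - flo x - 1.
Proof.
move=> h; apply: flo_unique; have := floP x.
suff: x != flo x * N by lia.
by apply: contra h => /eqP ->; rewrite dvdz_mull.
Qed.

Lemma flo_ge0 x : (0 <= flo x) = (0 <= x).
Proof. by rewrite /flo divz_ge0 ?period_gt0. Qed.

Lemma dvd_periodN x : (N %| - x)%Z = (N %| x)%Z.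
Proof. by rewrite rpredN. Qed.

Lemma dvd_periodDM x k : (N %| x + k * N)%Z = (N %| x)%Z.
Proof. by rewrite rpredDr // dvdz_mull. Qed.

Lemma dvd_periodDN x : (N %| x + N)%Z = (N %| x)%Z.
Proof. by rewrite rpredDr // dvdzz. Qed.

(** As [N = 2n + 1] is odd, [flo (x + n)] is the integer nearest to [x / N] and ties never occur, so
    mirroring [x] mirrors it. *)
Lemma half_flo_mirror x : flo (N - x + n%:Z) = 1 - flo (x + n%:Z).
Proof.
apply: flo_unique; have := floP (x + n%:Z); have := periodE.
by move: N (flo _) => M f; lia.
Qed.

Lemma half_floN x : flo (- x + n%:Z) = - flo (x + n%:Z).
Proof.
have -> : - x + n%:Z = N - x + n%:Z + (- 1) * N by lia.
by rewrite floDM half_flo_mirror; lia.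
Qed.

End Floor.

(** * Floor sums of a window under swaps, negations and mirrorings *)

Section PairSum.
Variable n : nat.
Local Notation N := (period n).
Local Notation window := ('I_n -> int).

(** Since [N] is odd, this says that [0] and all the [v i] and [- v i] lie in distinct residue
    classes modulo [N]; no floor of [v i], [v i - v j] or [v i + v j] is then taken at a multiple of
    [N]. *)
Definition regular (v : window) : Prop :=
  (forall i, ~~ (N %| v i)%Z) /\
  (forall i j, i != j -> ~~ (N %| v i - v j)%Z /\ ~~ (N %| v i + v j)%Z).

Definition pair_term (x y : int) : int :=
  `|flo n (y - x)| + `|flo n (x + y)|.

Definition pair_sum (v : window) : int :=
  \sum_(p : 'I_n * 'I_n | (p.1 < p.2)%N) pair_term (v p.1) (v p.2).

Definition even_sum (v : window) : int := \sum_(i < n) `|flo n (v i)|.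
Definition odd_sum (v : window) : int := \sum_(i < n) `|flo n (v i + n%:Z)|.

(** Negation turns a floor [f] into [- f - 1], of absolute value [f + 1] if [f >= 0] and [- f - 1]
    otherwise. The unit changes of [pair_sum] and [even_sum] come from here. *)
Lemma abs_floN x : ~~ (N %| x)%Z ->
  `|flo n (- x)| = `|flo n x| + (if 0 < x then 1 else - 1).
Proof.
move=> h; rewrite floN //; have xE := flo_ge0 n x.
have x0 : x != 0 by apply: contra h => /eqP ->; rewrite dvdz0.
by move: (flo n x) xE => f xE; case: (ltP 0 x) => ?; lia.
Qed.

Lemma pair_termC x y : ~~ (N %| y - x)%Z ->
  pair_term y x = pair_term x y + (if x < y then 1 else - 1).
Proof.
move=> h; rewrite /pair_term -(opprB y x) abs_floN // [y + x]addrC subr_gt0.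
by rewrite addrAC.
Qed.

Lemma pair_termN x y : pair_term (- x) y = pair_term x y.
Proof. by rewrite /pair_term opprK [y + x]addrC [- x + y]addrC [LHS]addrC. Qed.

(** The added [N] cancels the [- 1] of a negated floor: up to sign the two floors change places. *)
Lemma pair_term_mirror x y : ~~ (N %| x - y)%Z -> ~~ (N %| x + y)%Z ->
  pair_term x (N - y) = pair_term x y.
Proof.
move=> h1 h2; rewrite /pair_term.
have -> : N - y - x = - (x + y) + N by lia.
have -> : x + (N - y) = (x - y) + N by lia.
rewrite !floDN floN // -[y - x]opprB [flo n (- (x - y))]floN //.
by move: (flo n _) (flo n _) => f g; lia.
Qed.

(** At the first index this is right multiplication by [s0C]; [mirror_at] at the last index is right
    multiplication by [snC]. *)
Definition flip_at (i : 'I_n) (v : window) : window :=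
  fun j => if j == i then - v j else v j.
Definition mirror_at (i : 'I_n) (v : window) : window :=
  fun j => if j == i then N - v j else v j.

Lemma regular_flip i v : regular v -> regular (flip_at i v).
Proof.
move=> [h1 h2]; split=> [j|j k jk]; rewrite /flip_at.
  by case: eqP => _ //; rewrite dvd_periodN.
have [h3 h4] := h2 _ _ jk; have [e1|_] := eqVneq j i; have [e2|_] := eqVneq k i.
- by rewrite e1 e2 eqxx in jk.
- by rewrite -opprD dvd_periodN; split=> //; rewrite addrC -opprB dvd_periodN.
- by rewrite opprK.
- by [].
Qed.

Lemma regular_mirror i v : regular v -> regular (mirror_at i v).
Proof.
move=> /(regular_flip i) [h1 h2].
have E j : mirror_at i v j = flip_at i v j \/ mirror_at i v j = flip_at i v j + N.
  by rewrite /mirror_at /flip_at; case: ifP => _; [right; rewrite addrC|left].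
split=> [j|j k jk]; first by have [->|->] := E j; rewrite ?dvd_periodDN.
have [h3 h4] := h2 _ _ jk.
have [->|->] := E j; have [->|->] := E k => //; rewrite ?opprD ?addrA ?dvd_periodDN //;
 rewrite ?[_ + N - _]addrAC ?[_ + N + _]addrAC ?addrK ?dvd_periodDN //.
by split=> //; rewrite -dvd_periodDN subrK.
Qed.

Lemma regular_perm (s : {perm 'I_n}) v : regular v -> regular (v \o s).
Proof.
move=> [h1 h2]; split=> [j|j k jk] /=; first exact: h1.
by apply: h2; rewrite (inj_eq perm_inj).
Qed.

(** Because [i] and [j] are consecutive, exchanging them permutes the increasing pairs other than
    [(i, j)]; only the term of that pair changes. *)
Lemma pair_sum_swap (i j : 'I_n) v : regular v -> j = i.+1 :> nat ->
  pair_sum (v \o tperm i j) = pair_sum v + (if v i < v j then 1 else - 1).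
Proof.
move=> [_ vreg] ij.
have ltij : (i < j)%N by rewrite ij.
rewrite /pair_sum (bigD1 (i, j)) //= [in RHS](bigD1 (i, j)) //=.
rewrite tpermL tpermR pair_termC; last first.
  by have [] := vreg j i; rewrite ?neq_ltn ?ltij ?orbT.
rewrite -[LHS]addrA -[RHS]addrA; congr (_ + _).
rewrite [RHS]addrC; congr (_ + _).
have tpI : involutive (fun p : 'I_n * 'I_n => (tperm i j p.1, tperm i j p.2)).
  by move=> [x y]; rewrite /= !tpermK.
rewrite [LHS](reindex_inj (inv_inj tpI)) /=.
apply: eq_big => [[x y]|[x y] _] /=; last by rewrite !tpermK.
rewrite !xpair_eqE.
have neq_val (a b : 'I_n) : a <> b -> a <> b :> nat by move=> ab /val_inj.
rewrite -!(inj_eq val_inj) /=.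
by case: (tpermP i j x) => [->|->|/neq_val xi /neq_val xj];
  case: (tpermP i j y) => [->|->|/neq_val yi /neq_val yj]; lia.
Qed.

(** The first index occurs only as the left member of a pair, where a negation exchanges the two
    floors. *)
Lemma pair_sum_flip (i : 'I_n) v : i = 0%N :> nat ->
  pair_sum (flip_at i v) = pair_sum v.
Proof.
move=> i0; apply: eq_bigr => -[x y] /= xy; rewrite /flip_at.
have -> : (y == i) = false by rewrite -(inj_eq val_inj) /=; lia.
by case: eqP => // _; rewrite pair_termN.
Qed.

Lemma pair_sum_mirror (i : 'I_n) v : regular v -> i = n.-1 :> nat ->
  pair_sum (mirror_at i v) = pair_sum v.
Proof.
move=> [_ vreg] i0; apply: eq_bigr => -[x y] /= xy; rewrite /mirror_at.
have -> : (x == i) = false by rewrite -(inj_eq val_inj) /=; have := ltn_ord y; lia.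
case: eqP => // _; have [] := vreg x y; first by rewrite neq_ltn xy.
exact: pair_term_mirror.
Qed.

Lemma even_sum_perm (s : {perm 'I_n}) v : even_sum (v \o s) = even_sum v.
Proof. by rewrite /even_sum [RHS](reindex_perm s). Qed.

Lemma odd_sum_perm (s : {perm 'I_n}) v : odd_sum (v \o s) = odd_sum v.
Proof. by rewrite /odd_sum [RHS](reindex_perm s). Qed.

Lemma even_sum_flip i v : regular v ->
  even_sum (flip_at i v) = even_sum v + (if 0 < v i then 1 else - 1).
Proof.
move=> [h _]; rewrite /even_sum (bigD1 i) //= [in RHS](bigD1 i) //=.
rewrite {1}/flip_at eqxx abs_floN // -!addrA; congr (_ + _).
rewrite [RHS]addrC; congr (_ + _); apply: eq_bigr => j /negbTE ji.
by rewrite /flip_at ji.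
Qed.

Lemma odd_sum_flip i v : odd_sum (flip_at i v) = odd_sum v.
Proof.
by apply: eq_bigr => j _; rewrite /flip_at; case: ifP => // _; rewrite half_floN normrN.
Qed.

Lemma even_sum_mirror i v : regular v -> even_sum (mirror_at i v) = even_sum v.
Proof.
move=> [h _]; apply: eq_bigr => j _; rewrite /mirror_at; case: ifP => // _.
by rewrite [N - _]addrC floDN floN // subrK normrN.
Qed.

(** The integer [k] nearest to [v i / N] becomes [1 - k], so its absolute value grows exactly when
    [k <= 0], that is when [v i <= n]. *)
Lemma odd_sum_mirror i v :
  odd_sum (mirror_at i v) = odd_sum v + (if v i <= n%:Z then 1 else - 1).
Proof.
rewrite /odd_sum (bigD1 i) //= [in RHS](bigD1 i) //=.
rewrite {1}/mirror_at eqxx half_flo_mirror.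
have -> : `|1 - flo n (v i + n%:Z)| =
    `|flo n (v i + n%:Z)| + (if v i <= n%:Z then 1 else - 1).
  have := floP n (v i + n%:Z); have := periodE n; move: N (flo n _) => M f.
  by case: ifP; nia.
rewrite -!addrA; congr (_ + _).
rewrite [RHS]addrC; congr (_ + _); apply: eq_bigr => j /negbTE ji.
by rewrite /mirror_at ji.
Qed.

End PairSum.

(** * The action of the generators on windows *)

Section WindowAction.
Variable m : nat.
Local Notation n := m.+2.
Local Notation N := (period n).
Local Notation window := ('I_n -> int).
Local Notation o0 := (inord 0 : 'I_n).
Local Notation o1 := (inord 1 : 'I_n).
Local Notation ol' := (inord m : 'I_n).
Local Notation ol := (inord m.+1 : 'I_n).

(* [s_0^D] and [s_n^D] are the conjugates of [s_1] by [s_0^C] and of [s_{n-1}]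
   by [s_n^C]. *)
Definition act (t : abacus_type) (i : 'I_n.+1) (v : window) : window :=
  if i == 0%N :> nat then
    if x_first t == 0 then flip_at o0 v
    else flip_at o0 (flip_at o0 v \o tperm o0 o1)
  else if i == n :> nat then
    if x_last t == 0 then mirror_at ol v
    else mirror_at ol (mirror_at ol v \o tperm ol' ol)
  else v \o tperm (inord i.-1 : 'I_n) (inord i : 'I_n).

Definition ascent (t : abacus_type) (i : 'I_n.+1) (v : window) : bool :=
  if i == 0%N :> nat then
    if x_first t == 0 then 0 < v o0 else 0 < v o0 + v o1
  else if i == n :> nat then
    if x_last t == 0 then v ol <= n%:Z else v ol' + v ol < N
  else v (inord i.-1) < v (inord i).

Definition window_length (t : abacus_type) (v : window) : int :=
  pair_sum v + (1 + x_first t) * even_sum v + (1 + x_last t) * odd_sum v.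

Lemma flip_atK i : involutive (@flip_at n i).
Proof.
by move=> v; apply/funext => j; rewrite /flip_at; case: eqP => // _; rewrite opprK.
Qed.

Lemma mirror_atK i : involutive (@mirror_at n i).
Proof.
move=> v; apply/funext => j; rewrite /mirror_at; case: eqP => // _; lia.
Qed.

Lemma window_tpermK (i j : 'I_n) (v : window) :
  (v \o tperm i j) \o tperm i j = v.
Proof. by apply/funext => k /=; rewrite tpermK. Qed.

Lemma actK t i : involutive (act t i).
Proof.
move=> v; rewrite /act; case: (_ == 0%N); first case: (_ == 0).
- exact: flip_atK.
- by rewrite flip_atK window_tpermK flip_atK.
case: (_ == n); first case: (_ == 0).
- exact: mirror_atK.
- by rewrite mirror_atK window_tpermK mirror_atK.
exact: window_tpermK.
Qed.

Lemma act_regular t i v : regular v -> regular (act t i v).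
Proof.
move=> h; rewrite /act; case: ifP => _; first case: ifP => _.
- exact: regular_flip.
- by apply/regular_flip/regular_perm/regular_flip.
case: ifP => _; first case: ifP => _.
- exact: regular_mirror.
- by apply/regular_mirror/regular_perm/regular_mirror.
exact: regular_perm.
Qed.

Lemma ordE k : (k < n)%N -> (inord k : 'I_n) = k :> nat.
Proof. by move=> h; rewrite inordK. Qed.

Lemma ol'_neq : (ol' == ol) = false.
Proof. by rewrite -(inj_eq val_inj) /= !ordE //; lia. Qed.

Lemma o1_neq : (o1 == o0) = false.
Proof. by rewrite -(inj_eq val_inj) /= !ordE. Qed.

Lemma act_window_length t i v : regular v ->
  window_length t (act t i v) =
  window_length t v + (if ascent t i v then 1 else - 1).
Proof.
move=> h; rewrite /act /ascent /window_length.
case: eqP => [_|i0].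
  case: eqP => [x0|x0].
    rewrite pair_sum_flip ?ordE // even_sum_flip // odd_sum_flip x0.
    by case: ifP => _; lia.
  (* [even_sum] now has coefficient zero and both flips preserve [pair_sum]; what counts is the
     inner transposition, which compares [- v o0] with [v o1]. *)
  have -> : x_first t = - 1 by case: t x0.
  have hf := regular_flip o0 h.
  rewrite pair_sum_flip ?ordE // (pair_sum_swap hf) ?ordE //.
  rewrite pair_sum_flip ?ordE // odd_sum_flip odd_sum_perm odd_sum_flip.
  rewrite /flip_at eqxx o1_neq subrr !mul0r !addr0 -[- _ < _]subr_gt0 opprK.
  by rewrite [v o1 + _]addrC addrAC.
case: eqP => [_|iN].
  case: eqP => [xn|xn].
    rewrite pair_sum_mirror ?ordE // even_sum_mirror // odd_sum_mirror xn.
    by case: ifP => _; lia.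
  (* Likewise, the inner transposition compares [v ol'] with [N - v ol]. *)
  have -> : x_last t = - 1 by case: t xn.
  have hf := regular_mirror ol h.
  have hp := regular_perm (tperm ol' ol) hf.
  rewrite pair_sum_mirror ?ordE // (pair_sum_swap hf) ?ordE //.
  rewrite pair_sum_mirror ?ordE // !even_sum_mirror // even_sum_perm even_sum_mirror //.
  rewrite /mirror_at eqxx ol'_neq subrr !mul0r !addr0 ltrBrDr.
  by rewrite addrAC.
have iN' : (i < n)%N by have := ltn_ord i; lia.
rewrite pair_sum_swap ?ordE //; [|lia|lia].
by rewrite even_sum_perm odd_sum_perm; lia.
Qed.

Lemma abs_pm (b : bool) : (if b then 1 else - 1 : int) = 2 * (b : nat)%:Z - 1.
Proof. by case: b. Qed.

Lemma even_sum_ge0 (v : window) : 0 <= even_sum v.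
Proof. by apply: sumr_ge0 => i _; exact: normr_ge0. Qed.

Lemma odd_sum_ge0 (v : window) : 0 <= odd_sum v.
Proof. by apply: sumr_ge0 => i _; exact: normr_ge0. Qed.

Definition admissible (t : abacus_type) (v : window) : Prop :=
  [/\ regular v, x_first t = - 1 -> ~~ odd `|even_sum v|%N
    & x_last t = - 1 -> ~~ odd `|odd_sum v|%N].

(** A conjugated generator flips or mirrors two entries, each time changing the omitted sum by one
    up or down, so its parity survives; the other generators preserve that sum. *)
Lemma act_admissible t i v : admissible t v -> admissible t (act t i v).
Proof.
move=> [h he ho]; split; first exact: act_regular.
- move=> x0; move/(_ x0): he; rewrite /act x0 /=.
  have hp : regular (flip_at o0 v \o tperm o0 o1).
    by apply: regular_perm; apply: regular_flip.
  have := even_sum_ge0 v; case: eqP => [_|i0].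
    have := even_sum_ge0 (flip_at o0 (flip_at o0 v \o tperm o0 o1)).
    rewrite even_sum_flip // even_sum_perm even_sum_flip // !abs_pm.
    by move: (even_sum v) (0 < _) (0 < _) => x [] []; lia.
  case: eqP => [_|iN]; last by rewrite even_sum_perm.
  case: eqP => _; rewrite even_sum_mirror //; last first.
    by apply: regular_perm; apply: regular_mirror.
  by rewrite even_sum_perm even_sum_mirror.
- move=> xn; move/(_ xn): ho; rewrite /act xn /=.
  have := odd_sum_ge0 v; case: eqP => [_|i0].
    by case: eqP => _; rewrite odd_sum_flip // odd_sum_perm odd_sum_flip.
  case: eqP => [_|iN]; last by rewrite odd_sum_perm.
  have := odd_sum_ge0 (mirror_at ol (mirror_at ol v \o tperm ol' ol)).
  rewrite odd_sum_mirror // odd_sum_perm odd_sum_mirror // !abs_pm.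
  by move: (odd_sum v) (_ <= _) (_ <= _) => x [] []; lia.
Qed.

Lemma window_length_ge0 t v : 0 <= window_length t v.
Proof.
have := even_sum_ge0 v; have := odd_sum_ge0 v.
have : 0 <= pair_sum v.
  by apply: sumr_ge0 => p _; rewrite addr_ge0 ?normr_ge0.
by rewrite /window_length; case: t => /=; lia.
Qed.

Definition id_window : window := fun i => i.+1%:Z.

Lemma window_length_id t : window_length t id_window = 0.
Proof.
rewrite /window_length /pair_sum /even_sum /odd_sum /pair_term /id_window.
rewrite !big1 ?mulr0 ?addr0 //.
- by move=> i _; rewrite flo_small // /period; have := ltn_ord i; lia.
- by move=> i _; rewrite flo_small // /period; have := ltn_ord i; lia.
- move=> [i j] /= ij; rewrite !flo_small //; rewrite /period;
  have := ltn_ord i; have := ltn_ord j; lia.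
Qed.

(** * Windows in which every generator, or every parabolic one, is an ascent *)

Section Ascents.
Variables (t : abacus_type) (v : window).
Hypothesis vreg : regular v.
Let u k := v (inord k).

Lemma window_inord i : v i = u i. Proof. by rewrite /u inord_val. Qed.

Section Parabolic.
Hypothesis asc : forall i : 'I_n.+1, i != 0%N :> nat -> ascent t i v.

Lemma ascent_mono k : (k.+1 < n)%N -> u k < u k.+1.
Proof.
move=> hk; have := asc (i := inord k.+1); rewrite /ascent /= inordK; last by lia.
by rewrite /= ifF; [apply | lia].
Qed.

Lemma ascent_mono_lt i j : (i < j)%N -> (j < n)%N -> u i < u j.
Proof.
elim: j => // j IHj; rewrite ltnS leq_eqVlt => /predU1P[->|ij] jn.
  exact: ascent_mono.
by apply: (lt_trans (IHj ij (ltnW jn))); exact: ascent_mono.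
Qed.

Lemma ascent_last :
  if x_last t == 0 then u m.+1 <= n%:Z else u m + u m.+1 < N.
Proof.
by have := asc (i := inord n); rewrite /ascent /= inordK // eqxx; apply.
Qed.

Lemma ascent_last_sum : u m + u m.+1 < N.
Proof.
have := ascent_last; have := @ascent_mono m (leqnn _).
by rewrite /period; case: ifP => _; lia.
Qed.

(** From [u m < u m.+1] and [u m + u m.+1 < 2n + 1] one gets [u m <= n - 1]; each step to the left
    loses at least one more. *)
Lemma ascent_upper k : (k < m.+1)%N -> u k <= k.+1%:Z.
Proof.
move=> hk; rewrite -(subKn (hk : (k <= m)%N)); have := leq_subr k m.
move: (m - k)%N => d {k hk}; elim: d => [_|d IHd dm].
  rewrite subn0; have := ascent_last_sum; have := @ascent_mono m (leqnn _).
  by rewrite /period; lia.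
have := @ascent_mono (m - d.+1)%N; have := IHd (ltnW dm).
have -> : ((m - d.+1).+1 = m - d)%N by lia.
by move=> h /(_ _) h'; have : (m - d < n)%N by [lia]; lia.
Qed.

End Parabolic.

Hypothesis asc : forall i : 'I_n.+1, ascent t i v.
Let asc' (i : 'I_n.+1) : i != 0%N :> nat -> ascent t i v := fun=> asc i.

Lemma ascent_first : if x_first t == 0 then 0 < u 0%N else 0 < u 0%N + u 1%N.
Proof. by have := asc (inord 0); rewrite /ascent /= inordK. Qed.

Lemma first_neq0 : u 0%N != 0.
Proof. by have [h _] := vreg; apply: contra (h o0) => /eqP; rewrite /u => ->; rewrite dvdz0. Qed.

(** [u 0] is nonzero and less than [u 1], and either [0 < u 0] or [0 < u 0 + u 1]; each case forces
    [2 <= u 1], and monotonicity does the rest. *)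
Lemma ascent_lower k : (0 < k < n)%N -> k.+1%:Z <= u k.
Proof.
case: k => // k; elim: k => [_|k IHk hk].
  have := ascent_first; have := ascent_mono asc' (k := 0) isT; have := first_neq0.
  by case: ifP => _; lia.
by have := ascent_mono asc' hk; have := IHk (ltnW hk); lia.
Qed.

End Ascents.

(** The upper and lower bounds meet at the middle indices. The first entry may still be [1] or [- 1]
    and the last one [n] or [n + 1]; parity decides. *)
Lemma all_ascents_id t v : (min_rank t <= n)%N -> admissible t v ->
  (forall i, ascent t i v) -> v = id_window.
Proof.
move=> hn [vreg ve vo] asc; set u := fun k => v (inord k : 'I_n).
have asc' (i : 'I_n.+1) : i != 0%N :> nat -> ascent t i v by [].
have mono := ascent_mono asc'; have up := ascent_upper asc'.
have lo := ascent_lower vreg asc; have u00 := first_neq0 vreg.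
have first := ascent_first asc; have last := ascent_last asc'.
have lsum := ascent_last_sum asc'.
rewrite -!/(u _) in u00 first last lsum.
have mid k : (0 < k < m.+1)%N -> u k = k.+1%:Z.
  move=> hk; have := lo k; have := up k; rewrite -!/(u _).
  by move=> /(_ _) h1 /(_ _) h2; apply/eqP; rewrite eq_le h1 ?h2 //; lia.
have u0 : u 0%N = 1 \/ u 0%N = - 1 /\ x_first t = - 1.
  have := up 0%N isT; rewrite -/(u _) => up0.
  move: first; case: eqP => x0 first; first by left; lia.
  (* The rank is at least 3 here, so index 1 is a middle one and [u 1 = 2], whence [u 0 > - 2]. *)
  have m0 : (0 < m)%N by move: hn x0; case: (t) => //=; lia.
  have xm : x_first t = - 1 by case: (t) x0.
  by have := mid 1%N m0; lia.
have ul : u m.+1 = n%:Z \/ u m.+1 = n.+1%:Z /\ x_last t = - 1.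
  have := lo m.+1; rewrite leqnn => /(_ isT); rewrite -/(u _) => lol.
  move: last; case: eqP => xn last; first by left; lia.
  have m0 : (0 < m)%N by move: hn xn; case: (t) => //=; lia.
  have xm : x_last t = - 1 by case: (t) xn.
  by have := mid m; rewrite m0 leqnn => /(_ isT); move: lsum; rewrite /period; lia.
(* If [u 0] were [- 1], its floor would be [- 1] and all others [0], making [even_sum] equal to
   1. *)
have ev : u 0%N = 1.
  case: u0 => // -[u0 xm]; have := ve xm.
  rewrite /even_sum big_ord_recl /= big1 => [|i _].
    have -> : v ord0 = - 1 by rewrite -u0 /u; congr v; apply: val_inj; rewrite /= ordE.
    by have -> : flo n (- 1) = - 1 by apply: flo_unique; rewrite /period; lia.
  have -> : v (lift ord0 i) = u i.+1.
    by rewrite /u; congr v; apply: val_inj; rewrite /= ordE // ltnS ltn_ord.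
  rewrite flo_small //; have := ltn_ord i => hi.
  have [->|im] := eqVneq (i : nat) m; first by rewrite /period; case: ul => [|[]] -> //; lia.
  by rewrite mid ?/period; lia.
have od : u m.+1 = n%:Z.
  case: ul => // -[ul xm]; have := vo xm.
  rewrite /odd_sum big_ord_recr /= big1 => [|i _].
    have -> : v ord_max = n.+1%:Z by rewrite -ul /u; congr v; apply: val_inj; rewrite /= ordE.
    by have -> : flo n (n.+1%:Z + n%:Z) = 1 by apply: flo_unique; rewrite /period; lia.
  have -> : v (widen_ord (leqnSn m.+1) i) = u i.
    by rewrite /u; congr v; apply: val_inj; rewrite /= ordE //; have := ltn_ord i; lia.
  rewrite flo_small //; have := ltn_ord i => hi.
  have [->|im] := eqVneq (i : nat) 0%N; first by rewrite ev /period; lia.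
  by rewrite mid ?/period; lia.
apply/funext => i; rewrite window_inord -/(u _) /id_window; have hi := ltn_ord i.
have [->|i0] := eqVneq (i : nat) 0%N; first by rewrite ev.
have [->|il] := eqVneq (i : nat) m.+1; first by rewrite od.
by rewrite mid //; lia.
Qed.

End WindowAction.

(** * Equivariant maps *)

(** Leaves out the bijectivity of [mirrored]: [mirror_ext n f] satisfies this for every [f], so the
    generators can be handled before they are shown invertible. *)
Definition equivariant (n : nat) (w : int -> int) : Prop :=
  (forall i, w (i + period n) = w i + period n) /\ (forall i, w (- i) = - w i).

Definition window_of (n : nat) (w : int -> int) : 'I_n -> int :=
  fun i => w i.+1%:Z.

Section Equivariant.
Variable n : nat.
Local Notation N := (period n).

Lemma mirrored_equivariant w : mirrored n w -> equivariant n w.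
Proof. by case. Qed.

Lemma equivariant_comp f g : equivariant n f -> equivariant n g -> equivariant n (f \o g).
Proof. by move=> [f1 f2] [g1 g2]; split=> i /=; rewrite ?g1 ?g2. Qed.

Lemma equivariant_sub w i : equivariant n w -> w (N - i) = N - w i.
Proof. by move=> [w1 w2]; rewrite addrC w1 w2 addrC. Qed.

Lemma equivariant0 w : equivariant n w -> w 0 = 0.
Proof. by move=> [_ /(_ 0)]; rewrite oppr0; move: (w 0) => x; lia. Qed.

Lemma equivariant_shift w i k : equivariant n w -> w (i + k * N) = w i + k * N.
Proof.
move=> [w1 _]; have H (d : nat) j : w (j + d%:Z * N) = w j + d%:Z * N.
  elim: d j => [|d IHd] j; first by rewrite mul0r !addr0.
  by rewrite -addn1 PoszD mulrDl mul1r !addrA w1 IHd.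
case: (intP k) => [|d|d]; [exact: (H 0%N) | exact: H |].
by have := H d.+1 (i + - d.+1%:Z * N); rewrite -addrA mulNr addNr addr0; lia.
Qed.

Lemma equivariant_ext f g : equivariant n f -> equivariant n g ->
  window_of f = window_of g :> ('I_n -> int) -> f = g.
Proof.
move=> fe ge fg; apply/funext => z.
have small (k : nat) : (0 < k <= n)%N -> f k%:Z = g k%:Z.
  move=> /andP[k0 kn]; have kn' : (k.-1 < n)%N by lia.
  by have := congr1 (@^~ (Ordinal kn')) fg; rewrite /window_of /= prednK.
rewrite (divz_eq z N) addrC !equivariant_shift //; congr (_ + _).
have := modz_ge0 z (lt0r_neq0 (period_gt0 n)); have := ltz_pmod z (period_gt0 n).
case: (z %% N)%Z => [[|r]|//] rN _; first by rewrite !equivariant0.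
have [rn|rn] := leqP r.+1 n; first exact: small.
have := small (n.*2.+1 - r.+1)%N; rewrite -subzn; last by move: rN; rewrite /period; lia.
rewrite -/N !equivariant_sub // => h; apply: (@addrI _ N); apply: oppr_inj.
have : N - f r.+1 = N - g r.+1 by apply: h; move: rN; rewrite /period; lia.
by lia.
Qed.

Lemma mirror_extE f (k : nat) : (0 < k <= n)%N -> mirror_ext n f k%:Z = f k%:Z.
Proof.
move=> hk; rewrite /mirror_ext.
have -> : (k%:Z %/ N)%Z = 0.
  by rewrite -[LHS]/(flo n k%:Z) flo_small // /period; lia.
rewrite modz_small; last by rewrite /period; lia.
by rewrite ifF ?ifT ?mul0r ?addr0; lia.
Qed.

Lemma mirror_ext_equivariant f : equivariant n (mirror_ext n f).
Proof.
have N0 := lt0r_neq0 (period_gt0 n).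
have md x q r : x = q * N + r -> 0 <= r < N -> (x %/ N)%Z = q /\ (x %% N)%Z = r.
  move=> -> hr; rewrite divzMDl // modzMDl modz_small; last by rewrite hr.
  by rewrite -[(r %/ N)%Z]/(flo n r) flo_small // addr0.
have spec z : exists q r, z = q * N + r /\ 0 <= r < N.
  exists (z %/ N)%Z, (z %% N)%Z; split; first exact: divz_eq.
  by rewrite modz_ge0 // ltz_pmod // period_gt0.
have NE := periodE n.
split=> z; have [q [r [zE hr]]] := spec z; have [dz mz] := md z q r zE hr;
  rewrite /mirror_ext dz mz.
- have [-> ->] : ((z + N) %/ N)%Z = q + 1 /\ ((z + N) %% N)%Z = r.
    by apply: md => //; rewrite zE; lia.
  by case: eqP => // _; case: ifP => _; lia.
- case: (eqVneq r 0) => r0.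
    have [-> ->] : ((- z) %/ N)%Z = - q /\ ((- z) %% N)%Z = 0.
      by apply: md; [rewrite zE r0; lia | rewrite lexx period_gt0].
    by rewrite eqxx.
  have [-> ->] : ((- z) %/ N)%Z = - q - 1 /\ ((- z) %% N)%Z = N - r.
    by apply: md; [rewrite zE; lia | lia].
  case: eqP => [|_]; first by lia.
  have [rn|rn] := leP r n%:Z.
    rewrite ifF; last by lia.
    by have -> : N - (N - r) = r; lia.
  by rewrite ifT; lia.
Qed.

Lemma window_regular w : mirrored n w -> regular (@window_of n w).
Proof.
move=> wP; have we := mirrored_equivariant wP.
split=> [i|i j ij]; rewrite /window_of; have hi := ltn_ord i.
  by apply: (mirrored_entry wP); lia.
have hj := ltn_ord j; rewrite -(inj_eq val_inj) /= in ij; split.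
  apply/negP => h.
  have : i.+1 = j.+1.
    by apply: (mirrored_residue_inj wP); [lia | lia | apply/eqP; rewrite eqz_mod_dvd].
  by lia.
apply/negP => h.
have : i.+1 = (n.*2.+1 - j.+1)%N.
  apply: (mirrored_residue_inj wP); [lia | lia | apply/eqP].
  rewrite -subzn; last by lia.
  rewrite -/(period n) equivariant_sub // eqz_mod_dvd.
  by rewrite opprB addrA -dvd_periodDN subrK.
by lia.
Qed.

End Equivariant.

(** * Right multiplication by the generators, computed on windows *)

Section Generators.
Variable m : nat.
Local Notation n := m.+2.
Local Notation N := (period n).

Lemma gen_equivariant t i : equivariant n (gen t (i : 'I_n.+1)).
Proof.
by rewrite /gen; case: t; do 2 ?[case: ifP => _]; exact: mirror_ext_equivariant.
Qed.

Lemma window_gen t (i : 'I_n.+1) w : equivariant n w ->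
  window_of (w \o gen t i) = act t i (@window_of n w).
Proof.
move=> we; have [_ wN] := we.
(* The values at [n + 1] and [n + 2] are those that [snC] and [snD] bring in from outside the
   window; mirroring reads them back inside. *)
have wn : w n.+1%:Z = N - w n%:Z.
  by rewrite -equivariant_sub //; congr w; rewrite /period; lia.
have wn1 : w n.+2%:Z = N - w m.+1%:Z.
  by rewrite -equivariant_sub //; congr w; rewrite /period; lia.
apply/funext => j; rewrite /window_of /= /gen /act.
have hj := ltn_ord j.
have neq_val (a b : 'I_n) : a <> b -> a <> b :> nat by move=> ab /val_inj.
case: eqP => i0.
  have [->|j0] := eqVneq j (inord 0).
    case: t => /=; rewrite /s0C /s0D mirror_extE ?ordE //= wN /flip_at /= eqxx //;
    by rewrite ?tpermL ?o1_neq ordE.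
  have [->|j1] := eqVneq j (inord 1).
    case: t => /=; rewrite /s0C /s0D mirror_extE ?ordE //= /flip_at /= o1_neq ?ordE //;
    by rewrite ?tpermR ?eqxx ?ordE // wN.
  move: (j0) (j1); rewrite -!(inj_eq val_inj) /= !ordE // => j0' j1'.
  case: t => /=; rewrite /s0C /s0D mirror_extE //= /flip_at /= (negbTE j0) /= ?ifF //; try lia;
  by rewrite tpermD ?(negbTE j0) // eq_sym.
have el : (inord m.+1 : 'I_n) = m.+1 :> nat by rewrite inordK.
have em : (inord m : 'I_n) = m :> nat by rewrite inordK // ltnS.
case: eqP => iN.
  have [->|jl] := eqVneq j (inord m.+1).
    case: t => /=; rewrite /snC /snD mirror_extE ?el ?em //= /mirror_at /= eqxx ?el ?em //.
    - by rewrite eqxx -wn; congr w; lia.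
    - by rewrite eqxx -wn; congr w; lia.
    - rewrite ifF ?eqxx ?tpermR ?ol'_neq ?el ?em //; last by lia.
      by rewrite -wn1; congr w; lia.
    - rewrite ifF ?eqxx ?tpermR ?ol'_neq ?el ?em //; last by lia.
      by rewrite -wn1; congr w; lia.
  have [->|jl'] := eqVneq j (inord m).
    case: t => /=; rewrite /snC /snD mirror_extE ?el ?em //= /mirror_at /= ol'_neq ?el ?em //.
    - by rewrite ifF //; lia.
    - by rewrite ifF //; lia.
    - rewrite ifT ?tpermL ?eqxx ?el ?em //.
      by rewrite -wn; congr w; lia.
    - rewrite ifT ?tpermL ?eqxx ?el ?em //.
      by rewrite -wn; congr w; lia.
  move: (jl) (jl'); rewrite -!(inj_eq val_inj) /= el em => jl1 jl1'.
  case: t => /=; rewrite /snC /snD mirror_extE //= /mirror_at /= (negbTE jl) /= ?ifF //; try lia;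
  by rewrite tpermD ?(negbTE jl) // eq_sym.
have hi := ltn_ord i.
have i1 : (inord i.-1 : 'I_n) = i.-1 :> nat by rewrite inordK //; lia.
have i2 : (inord i : 'I_n) = i :> nat by rewrite inordK //; lia.
rewrite /s_mid mirror_extE //=.
have [->|j0] := eqVneq j (inord i.-1).
  by rewrite tpermL /= i2 ifT; [congr w|]; lia.
have [->|j1] := eqVneq j (inord i).
  rewrite tpermR /= i1 i2 ifF; last by lia.
  by rewrite ifT; [congr w|]; lia.
rewrite (tpermD (z := j)); [|by rewrite eq_sym|by rewrite eq_sym].
move: j0 j1; rewrite -!(inj_eq val_inj) /= i1 i2 => j0 j1.
by rewrite !ifF //; lia.
Qed.

Lemma genK t (i : 'I_n.+1) : gen t i \o gen t i = id.
Proof.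
have ge := gen_equivariant t i.
apply: (@equivariant_ext n) => //; first exact: equivariant_comp.
rewrite window_gen // -[gen t i]/(id \o gen t i) window_gen //.
exact: actK.
Qed.

Lemma comp_gen_mirrored t (i : 'I_n.+1) w : mirrored n w -> mirrored n (w \o gen t i).
Proof.
move=> wP; have [wb _ _] := wP; have [h1 h2] :=
  equivariant_comp (mirrored_equivariant wP) (gen_equivariant t i).
split=> //; apply: bij_comp => //; exists (gen t i);
  by move=> x; have := congr1 (@^~ x) (genK t i).
Qed.

End Generators.

(** * The length of a mirrored permutation *)

Lemma card_set_seq (A : set int) (s : seq int) :
  uniq s -> (forall b, A b <-> b \in s) -> card_set A = size s.
Proof.
move=> us As; have -> : A = [set` [fset x in s]%fset].
  apply/seteqP; split=> b /=; first by move=> /As; rewrite in_fset.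
  by rewrite in_fset => /As.
by rewrite /card_set set_fsetK card_fseq undup_id.
Qed.

(** Counts a set laid out in disjoint rows, [f i k] being the [k]-th element of row [i]. The parity
    sets, the beads beyond the window and the gaps are all counted this way. *)
Lemma card_set_family (I : finType) (f : I -> nat -> int) (K : I -> nat)
    (A : set int) :
  (forall i j k l, (k < K i)%N -> (l < K j)%N -> f i k = f j l -> i = j /\ k = l) ->
  (forall b, A b <-> exists i k, (k < K i)%N /\ b = f i k) ->
  card_set A = (\sum_i K i)%N.
Proof.
move=> finj AE.
rewrite (@card_set_seq A [seq f i k | i <- enum I, k <- iota 0 (K i)]).
- rewrite size_allpairs_dep sumnE big_map big_enum /=.
  by apply: eq_bigr => i _; rewrite size_iota.
- apply: allpairs_uniq_dep; [exact: enum_uniq | by move=> i _; exact: iota_uniq |].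
  move=> _ _ /allpairsPdep[i [k [_ hk ->]]] /allpairsPdep[j [l [_ hl ->]]] /= E.
  rewrite !mem_iota in hk hl.
  by have [ij kl] := finj _ _ _ _ hk hl E; rewrite -ij -kl.
- move=> b; rewrite AE; split=> [[i [k [hk ->]]]|].
    by apply/allpairsPdep; exists i, k; rewrite mem_enum mem_iota.
  by move=> /allpairsPdep[i [k [_ hk ->]]]; exists i, k; rewrite mem_iota in hk.
Qed.

(** * Coordinates for the entries, and the parity conditions as floor sums *)

Section Entries.
Variable n : nat.
Local Notation N := (period n).
Local Notation window := ('I_n -> int).

(** For regular [c], the index [i] and the sign [e] choose one of the [2n] runners, and [k] is the
    level relative to [c i] or [- c i]. *)
Definition entry (c : window) (i : 'I_n) (e : bool) (k : int) : int :=
  (if e then c i else - c i) + k * N.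

Definition complete (c : window) : Prop :=
  forall b, entries n b -> exists i e k, b = entry c i e k.

(** [N] is odd, so 2 is invertible modulo [N]. *)
Lemma dvd_periodD x : (N %| x + x)%Z = (N %| x)%Z.
Proof.
rewrite -[x + x]mulr2n -mulr_natr Gauss_dvdzl //.
rewrite /coprimez /gcdz /period /= -[n.*2.+1]addn1 -muln2.
by rewrite gcdnC gcdnMDl.
Qed.

(** A coincidence with [i != j] would violate regularity; with [i = j] and opposite signs, [N] would
    divide [c i + c i]. *)
Lemma entry_inj c i j e f k l : regular c ->
  entry c i e k = entry c j f l -> [/\ i = j, e = f & k = l].
Proof.
move=> [c1 c2] E; have [ij|ij] := eqVneq i j.
  subst j; have [ef|ef] := eqVneq e f.
    subst f; move: E => /addrI /(mulIf (lt0r_neq0 (period_gt0 n))) ->.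
    by split.
  have := c1 i; rewrite -dvd_periodD.
  suff -> : c i + c i = (if e then l - k else k - l) * N by rewrite dvdz_mull.
  by move: E ef; rewrite /entry; case: e; case: f => //=; lia.
have [h1 h2] := c2 _ _ ij.
have [ef|ef] := eqVneq e f.
  case/negP: h1; suff -> : c i - c j = (if e then l - k else k - l) * N.
    by rewrite dvdz_mull.
  by move: E; rewrite -ef /entry; case: (e); lia.
case/negP: h2; suff -> : c i + c j = (if e then l - k else k - l) * N.
  by rewrite dvdz_mull.
by move: E ef; rewrite /entry; case: (e); case: (f); lia.
Qed.

Lemma entry_entries c i e k : regular c -> entries n (entry c i e k).
Proof.
move=> [c1 _]; rewrite /entries /entry /= dvd_periodDM.
by case: e; rewrite ?dvd_periodN.
Qed.

Lemma complete_congr c d :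
  (forall i, exists e k, c i = entry d i e k) -> complete c -> complete d.
Proof.
move=> h hc b /hc[i [e [k ->]]]; have [f [l El]] := h i.
exists i, (e == f), (k + if e then l else - l).
by rewrite /entry El /entry; case: e; case: (f) => /=; lia.
Qed.

Lemma complete_window w : mirrored n w -> complete (window_of w).
Proof.
move=> wP b hb; have we := mirrored_equivariant wP.
have [j hj ej] := mirrored_residue_surj wP hb.
have /dvdzP[k kE] : (N %| b - w j)%Z by rewrite -eqz_mod_dvd ej.
have [jn|jn] := leqP j n.
  have hj' : (j.-1 < n)%N by lia.
  exists (Ordinal hj'), true, k; rewrite /entry /window_of /= prednK; lia.
have hj' : ((n.*2 - j) < n)%N by lia.
exists (Ordinal hj'), false, (k + 1); rewrite /entry /window_of /=.
have -> : (n.*2 - j).+1%:Z = N - j%:Z by rewrite /period; lia.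
by rewrite equivariant_sub //; lia.
Qed.

Lemma mirrored_id : mirrored n id.
Proof. by split=> //; exists id. Qed.

Lemma entry_id_mirrored w i e k : equivariant n w ->
  w (entry (window_of id) i e k) = entry (window_of w) i e k.
Proof.
move=> we; rewrite /entry equivariant_shift //; case: e => //.
by case: we => _ ->.
Qed.

Lemma ge0_divmod t r : 0 <= r < N -> (0 <= t * N + r) = (0 <= t).
Proof. by have := period_gt0 n; move: N => M h1 h2; apply/idP/idP; nia. Qed.

Lemma card_even_at_zero w : mirrored n w ->
  (card_set [set i : int | i <= 0 /\ 1 <= w i])%:Z = even_sum (@window_of n w).
Proof.
move=> wP; have we := mirrored_equivariant wP.
have rid : regular (@window_of n id) := window_regular mirrored_id.
pose q (i : 'I_n) := flo n (window_of w i).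
(* Put [x = window_of id i]. For [q i >= 0] the row is [x - N, x - 2N, ...], as [x] itself is
   positive; otherwise it is [- x, - x - N, ...]. *)
pose f (i : 'I_n) (k : nat) := if 0 <= q i then entry (window_of id) i true (- k.+1%:Z)
                               else entry (window_of id) i false (- k%:Z).
have qP i : exists r, 0 < r < N /\ window_of w i = q i * N + r.
  exists (window_of w i - q i * N); split; last by lia.
  have := floP n (window_of w i); rewrite -/(q i).
  have [/(_ i) h _] := window_regular wP.
  suff: window_of w i != q i * N by lia.
  by apply: contra h => /eqP ->; rewrite dvdz_mull.
have idP (i : 'I_n) : 0 < window_of id i < N.
  by rewrite /window_of /=; have := ltn_ord i; rewrite /period; lia.
rewrite (@card_set_family _ f (fun i => `|q i|%N)).
- by rewrite /even_sum -natz natr_sum; apply: eq_bigr => i _; rewrite natz abszE.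
- move=> i j k l _ _; rewrite /f; case: ifP => hi; case: ifP => hj /(entry_inj rid)[] ij // _ kl;
  by split=> //; lia.
move=> b; split=> [[/= b0 wb]|[i [k [hk ->]]]].
  have bE : entries n b.
    apply/negP => /dvdzP[k bk]; move: b0 wb.
    by rewrite bk -[k * N]add0r (equivariant_shift _ _ we) (equivariant0 we) add0r; lia.
  have [i [e [k bk]]] := complete_window mirrored_id bE.
  have [r [hr wE]] := qP i; have hid := idP i.
  move: b0 wb; rewrite {1 2}bk entry_id_mirrored // /entry wE; case: e bk => bk b0 wb.
    have k0 : k <= - 1.
      by have := @ge0_divmod k (window_of id i - 1); lia.
    have qk : 0 <= q i + k by rewrite -(@ge0_divmod _ r); lia.
    exists i, (absz (k + 1)); split; first by lia.
    rewrite /f ifT; last by lia.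
    by rewrite bk; congr entry; lia.
  have k0 : k <= 0.
    by have := @ge0_divmod (k - 1) (N - window_of id i - 1); lia.
  have qk : 0 <= k - q i - 1 by rewrite -(@ge0_divmod _ (N - r)); lia.
  exists i, `|k|%N; split; first by lia.
  rewrite /f ifF; last by lia.
  by rewrite bk; congr entry; lia.
have [r [hr wE]] := qP i; have hid := idP i; rewrite /f; case: ifP => hq /=.
  rewrite entry_id_mirrored // /entry wE; split; first by nia.
  have := @ge0_divmod (q i - k.+1%:Z) (r - 1); lia.
rewrite entry_id_mirrored // /entry wE; split; first by nia.
have := @ge0_divmod (- q i - k%:Z - 1) (N - r - 1); lia.
Qed.

Lemma card_even_at_n w : mirrored n w ->
  (card_set [set i : int | i <= n%:Z /\ n%:Z + 1 <= w i])%:Z =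
  odd_sum (@window_of n w).
Proof.
move=> wP; have we := mirrored_equivariant wP; have NE := periodE n.
have rid : regular (@window_of n id) := window_regular mirrored_id.
pose q (i : 'I_n) := flo n (window_of w i + n%:Z).
(* Both [window_of id i] and its negative are at most [n], so rows of either sign start at
   [k = 0]. *)
pose f (i : 'I_n) (k : nat) := entry (window_of id) i (0 <= q i) (- k%:Z).
have qP i : exists r, 0 <= r < N /\ window_of w i = q i * N + r - n%:Z.
  exists (window_of w i + n%:Z - q i * N); split; last by lia.
  by have := floP n (window_of w i + n%:Z); rewrite -/(q i); lia.
have idP (i : 'I_n) : 0 < window_of id i <= n%:Z.
  by rewrite /window_of /=; have := ltn_ord i; lia.
rewrite (@card_set_family _ f (fun i => `|q i|%N)).
- by rewrite /odd_sum -natz natr_sum; apply: eq_bigr => i _; rewrite natz abszE.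
- by move=> i j k l _ _; rewrite /f => /(entry_inj rid)[] ij // _ kl; split=> //; lia.
move=> b; split=> [[/= b0 wb]|[i [k [hk ->]]]].
  have bE : entries n b.
    apply/negP => /dvdzP[k bk]; move: b0 wb.
    by rewrite bk -[k * N]add0r (equivariant_shift _ _ we) (equivariant0 we) add0r; lia.
  have [i [e [k bk]]] := complete_window mirrored_id bE.
  have [r [hr wE]] := qP i; have hid := idP i; exists i, `|k|%N.
  suff [k0 [kq eE]] : k <= 0 /\ (`|k| < `|q i|)%N /\ e = (0 <= q i).
    by split; [lia | rewrite bk /f -eE; congr entry; lia].
  move: b0 wb; rewrite {1 2}bk entry_id_mirrored // /entry wE; case: e bk => bk b0 wb.
    have k0 : k <= 0.
      by have := @ge0_divmod (k - 1) (N + window_of id i - n%:Z - 1); lia.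
    have qk : 0 <= q i + k - 1 by rewrite -(@ge0_divmod _ r); lia.
    by lia.
  have k0 : k <= 0.
    by have := @ge0_divmod (k - 1) (N - window_of id i - n%:Z - 1); lia.
  have qk : 0 <= k - q i - 1 by rewrite -(@ge0_divmod _ (N - r - 1)); lia.
  by lia.
have [r [hr wE]] := qP i; have hid := idP i; rewrite /f /= entry_id_mirrored //.
case: (leP 0 (q i)) => hq; rewrite /entry wE.
- split; first by nia.
  by have := @ge0_divmod (q i - k%:Z - 1) r; lia.
- split; first by nia.
  by have := @ge0_divmod (- q i - k%:Z - 1) (N - r - 1); lia.
Qed.

End Entries.

(** * Coxeter length equals the window statistic *)

Section CoxeterLength.
Variable m : nat.
Local Notation n := m.+2.
Local Notation N := (period n).
Local Notation window := (@window_of n).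
Variable t : abacus_type.
Hypothesis hn : (min_rank t <= n)%N.

Lemma affine_admissible w : affine_group t n w ->
  admissible t (window w).
Proof.
move=> [wP wt]; split; first exact: window_regular.
- rewrite -card_even_at_zero // absz_nat => x0.
  by case: t x0 wt => //= _ [].
- rewrite -card_even_at_n // absz_nat => xn.
  by case: t xn wt => //= _ [].
Qed.

Lemma eval_word_rcons (s : seq 'I_n.+1) i :
  eval_word t (rcons s i) = eval_word t s \o gen t i.
Proof. by elim: s => //= j s ->. Qed.

Lemma window_length_gen w i : mirrored n w ->
  window_length t (window (w \o gen t (i : 'I_n.+1))) =
  window_length t (window w) + (if ascent t i (window w) then 1 else - 1).
Proof.
move=> wP; rewrite window_gen; last exact: mirrored_equivariant.
by rewrite act_window_length //; exact: window_regular.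
Qed.

Lemma eval_word_mirrored (s : seq 'I_n.+1) : mirrored n (eval_word t s).
Proof.
elim/last_ind: s => [|s i IHs]; first exact: mirrored_id.
by rewrite eval_word_rcons; exact: comp_gen_mirrored.
Qed.

Lemma window_length_word (s : seq 'I_n.+1) :
  window_length t (window (eval_word t s)) <= (size s)%:Z.
Proof.
elim/last_ind: s => [|s i IHs].
  by rewrite -[window _]/(@id_window m) window_length_id.
rewrite eval_word_rcons window_length_gen; last exact: eval_word_mirrored.
by rewrite size_rcons; case: ifP => _; lia.
Qed.

(** As long as some generator is not an ascent, multiplying by it lowers the statistic by one; by
    [all_ascents_id] the process can only stop at the identity. *)
Lemma reduced_word w : mirrored n w -> admissible t (window w) ->
  exists2 s : seq 'I_n.+1, (size s)%:Z = window_length t (window w)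
    & eval_word t s = w.
Proof.
have [d] : exists d : nat, window_length t (window w) = d%:Z.
  by exists `|window_length t (window w)|%N; rewrite gez0_abs // window_length_ge0.
elim: d w => [|d IHd] w dE wP wad;
  (have [/forallP asc|] := boolP [forall i, ascent t i (window w)];
    [have w_id := all_ascents_id hn wad asc; exists [::];
      [by rewrite w_id window_length_id
      | by apply/esym/(@equivariant_ext n) => //; exact: mirrored_equivariant]|]);
  rewrite negb_forall => /existsP[i /negbTE iasc];
  have := window_length_gen i wP; rewrite iasc dE => E.
  by have := window_length_ge0 t (window (w \o gen t i)); rewrite E.
have wP' := comp_gen_mirrored t i wP.
have wad' : admissible t (window (w \o gen t i)).
  by rewrite window_gen; [exact: act_admissible | exact: mirrored_equivariant].
have [|s sE sw] := IHd (w \o gen t i) _ wP' wad'; first by rewrite E; lia.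
exists (rcons s i); first by rewrite size_rcons -addn1 PoszD sE E; lia.
by rewrite eval_word_rcons sw -compA genK.
Qed.

Lemma coxeter_length_window w : mirrored n w -> admissible t (window w) ->
  (coxeter_length t n w)%:Z = window_length t (window w).
Proof.
move=> wP wad; have [s sE sw] := reduced_word wP wad.
rewrite -sE; congr Posz; apply: xget_unique.
  split; first by exists s.
  by move=> _ [s' <- sw']; rewrite -lez_nat sE -sw' window_length_word.
move=> k [[s' <- sw'] /(_ (size s)) h].
apply/eqP; rewrite eqn_leq h; last by exists s.
by rewrite -lez_nat sE -sw' window_length_word.
Qed.

(** Otherwise [w \o gen t i], an element of the same coset, would be shorter by one. *)
Lemma min_coset_rep_ascent w : min_coset_rep t n w ->
  forall i : 'I_n.+1, i != 0%N :> nat -> ascent t i (window w).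
Proof.
move=> [wA wmin] i i0; have [wP _] := wA; have wad := affine_admissible wA.
have := wmin (gen t i); rewrite -lez_nat => /(_ _).
have wP' := comp_gen_mirrored t i wP.
rewrite !coxeter_length_window //; last first.
  rewrite window_gen; first exact: act_admissible.
  exact: mirrored_equivariant.
rewrite window_length_gen //; case: ifP => // _.
suff hp : parabolic t n (gen t i) by move=> /(_ hp); lia.
by exists [:: i] => //=; rewrite i0.
Qed.

End CoxeterLength.

(** * Beads and gaps *)

Section LowestBeads.
Variable n : nat.
Local Notation N := (period n).
Local Notation window := ('I_n -> int).

Lemma regular_congr (c d : window) :
  (forall i, exists e k, d i = entry c i e k) -> regular c -> regular d.
Proof.
move=> h creg; have [c1 c2] := creg; split=> [i|i j ij].
  by have [e [k ->]] := h i; exact: entry_entries.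
have [e [k ->]] := h i; have [f [l ->]] := h j; have [h1 h2] := c2 _ _ ij.
rewrite /entry; case: e; case: f.
- have -> : c i + k * N - (c j + l * N) = c i - c j + (k - l) * N by lia.
  have -> : c i + k * N + (c j + l * N) = c i + c j + (k + l) * N by lia.
  by rewrite !dvd_periodDM.
- have -> : c i + k * N - (- c j + l * N) = c i + c j + (k - l) * N by lia.
  have -> : c i + k * N + (- c j + l * N) = c i - c j + (k + l) * N by lia.
  by rewrite !dvd_periodDM.
- have -> : - c i + k * N - (c j + l * N) = - (c i + c j) + (k - l) * N by lia.
  have -> : - c i + k * N + (c j + l * N) = - (c i - c j) + (k + l) * N by lia.
  by rewrite !dvd_periodDM !dvd_periodN.
- have -> : - c i + k * N - (- c j + l * N) = - (c i - c j) + (k - l) * N by lia.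
  have -> : - c i + k * N + (- c j + l * N) = - (c i + c j) + (k + l) * N by lia.
  by rewrite !dvd_periodDM !dvd_periodN.
Qed.

Lemma le_flo k x : (k <= flo n x) = (k * N <= x).
Proof.
by rewrite -[RHS]subr_ge0 -(flo_ge0 n) -mulNr floDM subr_ge0.
Qed.

Lemma le_flo_lt k x : ~~ (N %| x)%Z -> (k <= flo n x) = (k * N < x).
Proof.
move=> h; rewrite le_flo lt_neqAle; case: eqP => // kx.
by rewrite -kx dvdz_mull in h.
Qed.

(** This is [max (v i) (N - v i)]: as [N = 2n + 1], the second is larger exactly when [v i <= n]. *)
Definition lowest (v : window) : window :=
  fun i => if v i <= n%:Z then N - v i else v i.

Lemma lowest_entry v i : exists e k, lowest v i = entry v i e k.
Proof.
rewrite /lowest; case: ifP => _; [exists false, 1 | exists true, 0];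
  by rewrite /entry; lia.
Qed.

Lemma lowest_gt v i : n%:Z < lowest v i.
Proof.
by rewrite /lowest; case: (leP (v i)) => // h; rewrite periodE; lia.
Qed.

(* [base c i] is the b_i of the header, i.e. the paper's b(.) on the runner of
   the lowest bead [c i], and [height c i] is h_i. *)
Definition height (c : window) (i : 'I_n) : int := flo n (c i - n%:Z - 1).
Definition base (c : window) (i : 'I_n) : int := c i - height c i * N.

Lemma base_bounds c i : n%:Z < base c i <= N + n%:Z.
Proof. by have := floP n (c i - n%:Z - 1); rewrite /base -/(height c i); lia. Qed.

Lemma height_ge0 c i : n%:Z < c i -> 0 <= height c i.
Proof. by move=> h; rewrite /height flo_ge0; lia. Qed.

Variables (w : int -> int) (a : set int).
Hypotheses (wP : mirrored n w) (ha : abacus_of n w a).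
Local Notation c := (lowest (@window_of n w)).

Lemma lowest_regular : regular c.
Proof.
by apply: regular_congr (window_regular wP) => i; exact: lowest_entry.
Qed.

Lemma lowest_complete : complete c.
Proof.
apply: complete_congr (complete_window wP) => i.
by case hc: (window_of w i <= n%:Z); [exists false, 1 | exists true, 0];
  rewrite /entry /lowest hc; lia.
Qed.

Lemma bead_shift (j : nat) k : (0 < j <= n.*2)%N -> a (w j + k * N) <-> k <= 0.
Proof.
move=> hj; have N0 := period_gt0 n; have aE := (abacus_ofP wP a).1 ha.
split; last first.
  move=> k0; rewrite aE; exists j => //; split; last by nia.
  by rewrite /runner /= addrC modzMDl.
rewrite aE => -[i hi [ij li]]; have e : i = j.
  apply: (mirrored_residue_inj wP) => //.
  by rewrite -[LHS]ij addrC modzMDl.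
by move: li; rewrite e; nia.
Qed.

(** The two runners end in [c i] and [N - c i]; the latter has [k = 1] in the coordinates of
    [entry], hence the bound [~~ e]. *)
Lemma bead_entry i e k : a (entry c i e k) <-> k <= (~~ e)%:Z.
Proof.
have we := mirrored_equivariant wP; have hi := ltn_ord i.
have hi1 : (0 < i.+1 <= n.*2)%N by lia.
have hi2 : (0 < n.*2.+1 - i.+1 <= n.*2)%N by lia.
have E : w (n.*2.+1 - i.+1)%N = N - w i.+1.
  rewrite -equivariant_sub //; congr w; rewrite /period -subzn //; lia.
have := bead_shift (k - (~~ e)%:Z) hi1; have := bead_shift (k - (~~ e)%:Z) hi2.
rewrite E /entry /lowest /window_of.
case: (leP (w i.+1) n%:Z) => _; case: e => /= h1 h2.
- have -> : N - w i.+1 + k * N = N - w i.+1 + (k - 0) * N by lia.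
  by apply: (iff_trans h1); split; lia.
- have -> : - (N - w i.+1) + k * N = w i.+1 + (k - 1) * N by lia.
  by apply: (iff_trans h2); split; lia.
- have -> : w i.+1 + k * N = w i.+1 + (k - 0) * N by lia.
  by apply: (iff_trans h2); split; lia.
- have -> : - w i.+1 + k * N = N - w i.+1 + (k - 1) * N by lia.
  by apply: (iff_trans h1); split; lia.
Qed.

Lemma bead_is_entry b : a b -> exists i e k, b = entry c i e k.
Proof. by case: ha => aE _ _ /aE; exact: lowest_complete. Qed.

(** The runner of [- c i] ends at [N - c i <= n], so row [i] consists of [c i, c i - N, ...],
    stopping before [base c i]. *)
Lemma card_beads_gt :
  (card_set (a `&` [set b | N + n%:Z < b]))%:Z = \sum_i height c i.
Proof.
have N0 := period_gt0 n; have NE := periodE n.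
rewrite (@card_set_family _ (fun i k => entry c i true (- k%:Z)) (fun i => `|height c i|%N)).
- rewrite -natz natr_sum; apply: eq_bigr => i _.
  by rewrite natz gez0_abs // height_ge0 // lowest_gt.
- by move=> i j k l _ _ /(entry_inj lowest_regular)[] ij _ kl; split=> //; lia.
move=> b; split=> [[/= ab bN]|[i [k [hk ->]]]].
  have [i [e [k bE]]] := bead_is_entry ab; move: ab; rewrite bE bead_entry => hk.
  have hc := lowest_gt (window_of w) i.
  have := base_bounds c i; rewrite /base; have := height_ge0 hc.
  case: e bE hk => /= bE hk h0 hb; last by move: bN; rewrite bE /entry; nia.
  exists i, `|k|%N; split; last by congr entry; lia.
  have : 0 < height c i + k by move: bN; rewrite bE /entry; nia.
  by lia.
have := base_bounds c i; rewrite /base; have := height_ge0 (lowest_gt (window_of w) i).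
move=> h0 hb; split=> /=; first by rewrite bead_entry; lia.
by rewrite /entry; nia.
Qed.

Lemma base_inj i j : base c i = base c j -> i = j.
Proof.
move=> E; have := @entry_inj n c i j true true (- height c i) (- height c j) lowest_regular.
by rewrite /entry !mulNr => /(_ E)[].
Qed.

(** Each [base c i] is a bead because [height c i >= 0], and it is alone in its residue class
    between [n + 1] and [N + n]; the opposite runner has no bead beyond [n]. *)
Lemma sum_beads_window (F : int -> int) :
  \sum_(b \in a `&` [set b | N + 1 <= b <= N + n%:Z]) F b =
  \sum_(i | N < base c i) F (base c i).
Proof.
have N0 := period_gt0 n; have NE := periodE n.
have -> : a `&` [set b | N + 1 <= b <= N + n%:Z] =
    [set` [seq base c i | i <- enum 'I_n & N < base c i]].
  apply/seteqP; split=> b /=.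
    move=> [ab hb]; have [i [e [k bE]]] := bead_is_entry ab.
    move: ab; rewrite bE bead_entry => hk.
    have hc := lowest_gt (window_of w) i.
    have hB := base_bounds c i.
    case: e bE hk => /= bE hk; last by move: hb; rewrite bE /entry; nia.
    have kE : b = base c i.
      have : height c i + k = 0 by move: hb hB; rewrite bE /entry /base; nia.
      by rewrite bE /entry /base; nia.
    rewrite -bE kE; apply: map_f; rewrite mem_filter mem_enum -kE andbT; lia.
  move=> /mapP[i]; rewrite mem_filter => /andP[hi _] ->.
  have hB := base_bounds c i; split; last by lia.
  have -> : base c i = entry c i true (- height c i) by rewrite /base /entry mulNr.
  by rewrite bead_entry; have := height_ge0 (lowest_gt (window_of w) i) => /=; lia.
have us : uniq [seq base c i | i <- enum 'I_n & N < base c i].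
  rewrite map_inj_in_uniq; first exact/filter_uniq/enum_uniq.
  by move=> i j _ _; exact: base_inj.
by rewrite -fsbig_seq // big_map big_filter big_enum_cond.
Qed.

Lemma entryP (x y : int) : (x = y %[mod N])%Z -> exists k, x = y + k * N.
Proof. by move/eqP; rewrite eqz_mod_dvd => /dvdzP[k hk]; exists k; rewrite -hk; lia. Qed.

(** [c i > n] exceeds [N - c i], the end of the opposite runner; the label [r] may lie on either of
    the two. *)
Lemma lowest_beadE (r : nat) i e k : r%:Z = entry c i e k -> lowest_bead n a r = c i.
Proof.
move=> rE; have N0 := period_gt0 n; have hc := lowest_gt (window_of w) i.
have NE := periodE n.
suff maxc : is_max (a `&` (runner n r%:Z `|` runner n (N - r%:Z))) (c i).
  rewrite /lowest_bead; apply: xget_unique => // b [h1 h2]; case: maxc => h3 h4.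
  by apply/eqP; rewrite eq_le h4 ?h2.
split.
  split; first by have := (bead_entry i true 0).2 isT; rewrite /entry mul0r addr0.
  rewrite rE /entry; case: (e); [left | right]; rewrite /runner /=.
    by rewrite addrC modzMDl.
  have -> : N - (- c i + k * N) = (1 - k) * N + c i by lia.
  by rewrite modzMDl.
move=> b [ab rb]; have [j [f [l bE]]] := bead_is_entry ab.
have [f' [l' bE']] : exists f' l', b = entry c i f' l'.
  case: rb => /entryP[q ->]; rewrite rE.
    by exists e, (k + q); rewrite /entry; lia.
  by exists (~~ e), (1 - k + q); rewrite /entry; case: (e) => /=; lia.
have /bead_entry hl : a (entry c i f' l') by rewrite -bE'.
by rewrite bE' /entry; case: (f') hl => /=; nia.
Qed.

Lemma window_beadE (r : nat) i : lowest_bead n a r = c i ->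
  window_bead n a r = base c i.
Proof.
move=> rE; have N0 := period_gt0 n; have hc := lowest_gt (window_of w) i.
have hB := base_bounds c i.
have bE : base c i = entry c i true (- height c i) by rewrite /base /entry mulNr.
rewrite /window_bead rE; apply: xget_unique.
  split; [|by lia|].
    by rewrite bE bead_entry; have := height_ge0 hc => /=; lia.
  by rewrite /runner /= bE /entry addrC modzMDl.
move=> b [ab hb /entryP[q bq]].
have : q + height c i = 0 by move: hB hb; rewrite bq /base; nia.
by rewrite bq /base; nia.
Qed.

(** On the runner of [c j] the gaps are [c j + k N] with [k >= 1], all beyond [base c i]; if
    [c j <= c i], then [flo (c i - c j)] of them precede [c i]. On the opposite runner the gaps in
    range are [- c j + k N] with [flo (base c i + c j) < k <= flo (c i + c j)], which makes
    [height c i] values for every [j]. *)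
Lemma gaps_betweenE (r : nat) i : lowest_bead n a r = c i ->
  (gaps_between n a r)%:Z =
  n%:Z * height c i + \sum_j (if c j <= c i then flo n (c i - c j) else 0).
Proof.
move=> rE; have N0 := period_gt0 n; have hc j := lowest_gt (window_of w) j.
have NE := periodE n; have hB := base_bounds c i; have h0 := height_ge0 (hc i).
have creg := lowest_regular; have [c1 c2] := creg.
pose K (p : 'I_n * bool) : nat :=
  if p.2 then if c p.1 <= c i then `|flo n (c i - c p.1)|%N else 0%N else `|height c i|%N.
pose f (p : 'I_n * bool) (k : nat) :=
  entry c p.1 p.2 (if p.2 then k.+1%:Z else flo n (base c i + c p.1) + k.+1%:Z).
have flo_sum j : flo n (c i + c j) = flo n (base c i + c j) + height c i.
  rewrite -floDM; congr flo; rewrite /base; lia.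
rewrite /gaps_between (window_beadE rE) rE (@card_set_family _ f K).
- rewrite -natz natr_sum -(pair_bigA _ (fun j e => (K (j, e))%:R : int)) /=.
  have -> : n%:Z * height c i = \sum_(j < n) height c i.
    by rewrite sumr_const card_ord -mulr_natr mulrC natz.
  rewrite -big_split /=; apply: eq_bigr => j _.
  rewrite big_bool /K /= addrC !natz gez0_abs //; congr (_ + _).
  by case: ifP => // hj; rewrite gez0_abs // flo_ge0; lia.
- move=> [j e] [j' e'] k k' _ _ /(entry_inj creg)[/= jj' ee' kk'].
  by subst; split=> //; case: (e') kk'; lia.
move=> b; split=> [[[/= be nab] hb]|[[j e] [k [/= hk ->]]]].
  have [j [e [k bE]]] := lowest_complete be.
  have hk : (~~ e)%:Z < k by rewrite ltNge; apply/negP => h; apply: nab; rewrite bE bead_entry.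
  have hj := hc j; have hi := hc i.
  case: e bE hk => /= bE hk; have hb' := hb; rewrite bE /entry in hb'.
    exists (j, true), `|k - 1|%N; split; last by rewrite /f /= bE; congr entry; lia.
    have kN : N <= k * N by rewrite ler_peMl //; lia.
    have : k <= flo n (c i - c j) by rewrite le_flo; lia.
    by rewrite /K /= ifT; lia.
  exists (j, false), `|(k - 1 - flo n (base c i + c j))%R|%N.
  have k1 : flo n (base c i + c j) < k by rewrite ltNge le_flo -ltNge; lia.
  have k2 : k <= flo n (c i + c j) by rewrite le_flo; lia.
  split; last by rewrite /f /= bE; congr entry; lia.
  by rewrite /K /=; have := flo_sum j; lia.
have hj := hc j; have hi := hc i; split.
  split; first exact: entry_entries.
  rewrite /f /= bead_entry; case: e hk => /= hk; first by lia.
  (* Both summands exceed [n], so the row starts at some [k >= 2], past the last bead [N - c j]. *)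
  have : 1 <= flo n (base c i + c j) by rewrite le_flo; lia.
  by lia.
rewrite /f /entry /=; case: e hk; rewrite /K /=.
  case: (leP (c j) (c i)) => // cji hk.
  have ij : i != j by apply: contraTneq hk => ->; rewrite subrr flo_small // lexx.
  have [hd _] := c2 _ _ ij.
  have : k.+1%:Z <= flo n (c i - c j) by have := flo_ge0 n (c i - c j); lia.
  have kN : N <= k.+1%:Z * N by rewrite ler_peMl //; lia.
  by rewrite le_flo_lt //; lia.
move=> hk.
(* Excludes [- c j + k N = c i], so the last gap counted lies strictly before [c i]. *)
have hd : ~~ (N %| c i + c j)%Z.
  have [<-|ij] := eqVneq i j; first by rewrite dvd_periodD.
  by have [] := c2 _ _ ij.
have : flo n (base c i + c j) + k.+1%:Z <= flo n (c i + c j) by rewrite flo_sum; lia.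
rewrite le_flo_lt //.
have : ~~ (flo n (base c i + c j) + k.+1%:Z <= flo n (base c i + c j)) by lia.
by rewrite le_flo; lia.
Qed.

End LowestBeads.

(** * Minimal coset representatives *)

Lemma sum_pairs_sym n (F : 'I_n -> 'I_n -> int) :
  \sum_(p : 'I_n * 'I_n | (p.1 < p.2)%N) (F p.1 p.2 + F p.2 p.1) =
  \sum_i \sum_(j | j != i) F i j.
Proof.
rewrite big_split /=.
have swapI : involutive (fun p : 'I_n * 'I_n => (p.2, p.1)) by case.
rewrite [X in _ + X](reindex_inj (inv_inj swapI)) /= pair_big_dep /=.
rewrite [RHS](bigID (fun p : 'I_n * 'I_n => (p.1 < p.2)%N)) /=.
by congr (_ + _); apply: eq_bigl => -[i j] /=; rewrite -(inj_eq val_inj) /=; lia.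
Qed.

(** * The bases as signed distances from the period *)

Section BaseSums.
Variable m : nat.
Local Notation n := m.+2.
Local Notation N := (period n).
Variable c : 'I_n -> int.
Hypothesis creg : regular c.

(** The permutation [|b_i - N|] of [1, ..., n], shifted to start at 0; by [class_ofE], [inord] never
    takes its default. It also numbers the pair of runners to which [c i] belongs. *)
Definition class_of (i : 'I_n) : 'I_n := inord `|base c i - N|%N.-1.

Lemma base_neq i : base c i != N.
Proof.
have [h _] := creg; apply: contra (h i) => /eqP E.
have -> : c i = (height c i + 1) * N by move: E; rewrite /base; lia.
by rewrite dvdz_mull.
Qed.

Lemma class_ofE i : (class_of i).+1%:Z = `|base c i - N|.
Proof.
have := base_bounds c i; have := base_neq i; have := periodE n => NE hb hB.
by rewrite /class_of inordK; lia.
Qed.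

Lemma class_of_entry i : exists e k, (class_of i).+1%:Z = entry c i e k.
Proof.
rewrite class_ofE; case: (leP N (base c i)) => h.
  by exists true, (- height c i - 1); rewrite /entry /= ger0_norm; [rewrite /base; lia | lia].
by exists false, (height c i + 1); rewrite /entry /= ltr0_norm; [rewrite /base; lia | lia].
Qed.

Lemma class_of_inj : injective class_of.
Proof.
move=> i j ij; have [e [k E]] := class_of_entry i; have [f [l]] := class_of_entry j.
by rewrite -ij E => /(entry_inj creg)[].
Qed.

Lemma flo_base i : flo n (c i) = height c i + (nat_of_bool (N < base c i))%:Z.
Proof.
have -> : c i = base c i + height c i * N by rewrite /base; lia.
rewrite floDM addrC; congr (_ + _); apply: flo_unique.
have := base_bounds c i; have := base_neq i; have := periodE n => NE hb hB.
by case: ltP => h; lia.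
Qed.

(** The two bases add up to [2N] plus two signed distances of distinct sizes at most [n]; the sign
    of the larger decides between the floors 1 and 2. *)
Lemma flo_base_add i j : i != j ->
  flo n (c i + c j) - 1 = height c i + height c j
   + (nat_of_bool ((N < base c i) && (class_of j < class_of i)%N))%:Z
   + (nat_of_bool ((N < base c j) && (class_of i < class_of j)%N))%:Z.
Proof.
move=> ij.
have -> : c i + c j = base c i + base c j + (height c i + height c j) * N.
  by rewrite /base; lia.
rewrite floDM.
suff -> : flo n (base c i + base c j) =
   (nat_of_bool ((N < base c i) && (class_of j < class_of i)%N))%:Z
   + (nat_of_bool ((N < base c j) && (class_of i < class_of j)%N))%:Z + 1 by lia.
have cij : class_of i != class_of j :> nat.
  by rewrite (inj_eq val_inj) (inj_eq class_of_inj).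
have := base_bounds c i; have := base_neq i; have := class_ofE i.
have := base_bounds c j; have := base_neq j; have := class_ofE j.
have := periodE n; move: (class_of i) (class_of j) cij => ci cj cij.
move: (base c i) (base c j) => x y NE h1 h2 h3 h4 h5 h6.
apply: flo_unique; move: N NE h1 h2 h3 h4 h5 h6 => M NE h1 h2 h3 h4 h5 h6.
by case: (ltP M x) => hx; case: (ltP M y) => hy; rewrite ?andTb ?andFb;
  case: (ltngtP ci cj) => hc; lia.
Qed.

Lemma card_lt_class (i : 'I_n) :
  \sum_(j | j != i) (nat_of_bool (class_of j < class_of i)%N)%:Z = (class_of i)%:Z.
Proof.
transitivity (\sum_j (nat_of_bool (class_of j < class_of i)%N)%:Z).
  by rewrite [RHS](bigD1 i) //= ltnn add0r.
rewrite -(@reindex_inj _ _ _ _ _ xpredT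
  (fun j : 'I_n => (nat_of_bool (j < class_of i)%N)%:Z) class_of_inj).
have lt := ltn_ord (class_of i).
have -> : \sum_(j < n) (nat_of_bool (j < class_of i)%N)%:Z = (\sum_(j < n | (j < class_of i)%N) 1)%N%:Z.
  rewrite -natz natr_sum [RHS]big_mkcond /=; apply: eq_bigr => j _.
  by case: ltnP.
congr Posz; rewrite -(big_ord_widen n (fun=> 1%N)) ?(ltnW lt) //.
by rewrite sum1_card card_ord.
Qed.

Lemma sum_flo_add :
  \sum_(p : 'I_n * 'I_n | (p.1 < p.2)%N) (flo n (c p.1 + c p.2) - 1) =
  (m.+1)%:Z * (\sum_i height c i) + \sum_(i | N < base c i) (base c i - N - 1).
Proof.
(* [F i j] is the share of [i] in the pair: a base beyond [N] collects one for each smaller class,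
   [class_of i = base c i - N - 1] in all. *)
pose F (i j : 'I_n) := height c i + (nat_of_bool ((N < base c i) && (class_of j < class_of i)%N))%:Z.
transitivity (\sum_(p : 'I_n * 'I_n | (p.1 < p.2)%N) (F p.1 p.2 + F p.2 p.1)).
  apply: eq_bigr => -[i j] /= ij; rewrite flo_base_add /F; first by lia.
  by rewrite neq_ltn ij.
rewrite sum_pairs_sym mulr_sumr [X in _ = _ + X]big_mkcond -big_split /=.
apply: eq_bigr => i _; rewrite big_split /=; congr (_ + _).
  rewrite sumr_const cardC1 card_ord -mulr_natr mulrC natz.
  by [].
case: ifP => h; last by rewrite big1.
by rewrite card_lt_class; have := class_ofE i; lia.
Qed.

End BaseSums.

(** * The length of a minimal coset representative in terms of beads *)

Section MinimalRepresentative.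
Variables (m : nat) (t : abacus_type) (w : int -> int) (a : set int).
Local Notation n := m.+2.
Local Notation N := (period n).
Local Notation v := (@window_of n w).
Local Notation c := (lowest v).
Hypotheses (wP : mirrored n w) (ha : abacus_of n w a).
Hypothesis asc : forall i : 'I_n.+1, i != 0%N :> nat -> ascent t i v.
Let u k := v (inord k).

Lemma window_le i : (i < m.+1)%N -> u i <= n%:Z.
Proof. by move=> hi; have := ascent_upper asc hi; rewrite -/(u i); lia. Qed.

(** Two entries before the last sum to at most [2n]; if the last one takes part, monotonicity
    reduces to the pair [m], [m.+1]. *)
Lemma sum_lt_period (i j : 'I_n) : (i < j)%N -> v i + v j < N.
Proof.
move=> ij; have hj := ltn_ord j; rewrite (window_inord v i) (window_inord v j).
have := ascent_last_sum asc; rewrite -!/(u _) => hl.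
have [jm|jm] := eqVneq (j : nat) m.+1; last first.
  have := @window_le i; have := @window_le j; have := periodE n; lia.
rewrite jm; have [->//|im] := eqVneq (i : nat) m.
by have := ascent_mono_lt asc (i := i) (j := m); rewrite -!/(u _); lia.
Qed.

Lemma window_lt (i j : 'I_n) : (i < j)%N -> v i < v j.
Proof.
move=> ij; rewrite (window_inord v i) (window_inord v j).
by apply: (ascent_mono_lt asc ij); exact: ltn_ord.
Qed.

Lemma lowest_low (i j : 'I_n) : (i < j)%N -> c i = N - v i.
Proof.
move=> ij; rewrite /lowest ifT // window_inord; apply: window_le.
by have := ltn_ord j; lia.
Qed.

(** [c i = N - v i] because [i] is not the last index, while [c j] is [v j] or [N - v j]; the two
    cases are [sum_lt_period] and [window_lt]. *)
Lemma lowest_lt (i j : 'I_n) : (i < j)%N -> c j < c i.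
Proof.
move=> ij; rewrite (lowest_low ij) /lowest.
by have := window_lt ij; have := sum_lt_period ij; case: ifP => _; lia.
Qed.

(** Here [v i = N - c i], and mirroring [v j] into [c j] preserves the term; [n < c j < c i] then
    fixes the signs of both floors. *)
Lemma pair_term_lowest (i j : 'I_n) : (i < j)%N ->
  pair_term n (v i) (v j) = flo n (c i - c j) + (flo n (c i + c j) - 1).
Proof.
move=> ij; have [_ vreg] := window_regular wP.
have ne : i != j by rewrite neq_ltn ij.
have -> : pair_term n (v i) (v j) = pair_term n (N - c i) (c j).
  rewrite (lowest_low ij) /lowest; have -> : N - (N - v i) = v i by lia.
  by case: ifP => // _; have [h1 h2] := vreg _ _ ne; rewrite pair_term_mirror.
have [_ /(_ _ _ ne)[h1 h2]] := lowest_regular wP.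
have lt := lowest_lt ij; have g1 := lowest_gt v i; have g2 := lowest_gt v j.
rewrite /pair_term.
have -> : c j - (N - c i) = c i + c j + (- 1) * N by lia.
have -> : N - c i + c j = - (c i - c j) + 1 * N by lia.
rewrite !floDM floN // addrC; congr (_ + _).
  by have := flo_ge0 n (c i - c j); lia.
rewrite ger0_norm //.
have := le_flo n 1 (c i + c j); have := periodE n; lia.
Qed.

Lemma even_sum_lowest : even_sum v = \sum_i flo n (c i).
Proof.
apply: eq_bigr => i _; have [h _] := window_regular wP.
have := lowest_gt v i; rewrite /lowest; case: ifP => _ h'.
  have -> : N - v i = - v i + 1 * N by lia.
  have := flo_ge0 n (- v i + 1 * N); rewrite floDM floN //; lia.
by have := flo_ge0 n (v i); lia.
Qed.

(** When [x_last t = 0] the last ascent bounds the last entry by [n] as well, so [c i = N - v i] for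
    every [i]. *)
Lemma odd_sum_lowest : x_last t = 0 -> odd_sum v = \sum_i height c i.
Proof.
move=> xn; have NE := periodE n; apply: eq_bigr => i _.
have vn : v i <= n%:Z.
  rewrite window_inord; have := ascent_last asc; rewrite xn eqxx -/(u _) => h.
  have := @window_le i; rewrite /u => h'; have := ltn_ord i => hi.
  by have [->//|il] := eqVneq (i : nat) m.+1; apply: h'; lia.
have := half_flo_mirror n (v i); have := height_ge0 (lowest_gt v i).
rewrite /height /lowest vn.
have -> : N - v i + n%:Z = N - v i - n%:Z - 1 + 1 * N by lia.
by rewrite floDM; move: (flo n _) (flo n _) => x y; lia.
Qed.

Lemma sum_gaps_between :
  \sum_(1 <= i < n.+1) (gaps_between n a i)%:Z =
  n%:Z * (\sum_i height c i) +
  \sum_(p : 'I_n * 'I_n | (p.1 < p.2)%N) flo n (c p.1 - c p.2).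
Proof.
have creg := lowest_regular wP.
(* The lowest bead on runner [(class_of i).+1] and its mirror image is [c i], so this reindexing
   sums over the [c i]. *)
rewrite big_add1 big_mkord /= (reindex_inj (class_of_inj creg)) /=.
under eq_bigr => i _.
  have [e [k E]] := class_of_entry creg i.
  rewrite (gaps_betweenE wP ha (lowest_beadE wP ha E)).
  over.
rewrite big_split /= -mulr_sumr; congr (_ + _).
rewrite pair_big /= big_mkcond [RHS]big_mkcond /=; apply: eq_bigr => -[i j] _ /=.
have [ij|ji|/val_inj ->] := ltngtP i j.
- by rewrite (ltW (lowest_lt ij)).
- by rewrite leNgt (lowest_lt ji).
- by rewrite lexx subrr flo_small // lexx period_gt0.
Qed.

(** The heights get [n - 1] from [pair_sum], [1 + x_first t] from [even_sum] and [1 + x_last t] from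
    [odd_sum]: that is [n] for the gaps and [1 + x_first t + x_last t] for the beads beyond [N + n].
    Each base beyond [N] gets [base - N - 1] from [pair_sum] and [1 + x_first t] from [even_sum]. *)
Lemma window_length_beads :
  window_length t v =
    \sum_(1 <= i < n.+1) (gaps_between n a i)%:Z
    + (1 + x_first t + x_last t)
      * (card_set (a `&` [set b | N + n%:Z < b]))%:Z
    + \sum_(b \in a `&` [set b | N + 1 <= b <= N + n%:Z])
        (b - N + x_first t).
Proof.
have creg := lowest_regular wP.
rewrite sum_gaps_between (card_beads_gt wP ha) (sum_beads_window wP ha) /window_length.
have -> : pair_sum v =
   \sum_(p : 'I_n * 'I_n | (p.1 < p.2)%N) flo n (c p.1 - c p.2) +
   \sum_(p : 'I_n * 'I_n | (p.1 < p.2)%N) (flo n (c p.1 + c p.2) - 1).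
  by rewrite -big_split; apply: eq_bigr => -[i j] /=; exact: pair_term_lowest.
rewrite sum_flo_add // even_sum_lowest.
have -> : (1 + x_last t) * odd_sum v = (1 + x_last t) * \sum_i height c i.
  by case xn: (x_last t == 0); [rewrite odd_sum_lowest //; exact/eqP
    | case: (t) xn => //=; rewrite !addrN !mul0r].
have -> : \sum_i flo n (c i) = \sum_i height c i + \sum_(i | N < base c i) 1.
  rewrite [X in _ + X]big_mkcond -big_split; apply: eq_bigr => i _.
  by rewrite flo_base //; case: (N < _).
have -> : \sum_(i | N < base c i) (base c i - N + x_first t) =
   \sum_(i | N < base c i) (base c i - N - 1)
   + (1 + x_first t) * \sum_(i | N < base c i) 1.
  by rewrite mulr_sumr -big_split; apply: eq_bigr => i _ /=; lia.
move: (\sum_i height c i) (\sum_(i | _) 1) (\sum_(i | _) (_ - 1)) (\sum_(p | _) _).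
by move=> h s b p; lia.
Qed.

End MinimalRepresentative.

Theorem corollary8p1 (t : abacus_type) (n : nat) (w : int -> int)
    (a : set int) (hn : (min_rank t <= n)%N)
    (hw : min_coset_rep t n w) (ha : abacus_of n w a) :
  (coxeter_length t n w)%:Z =
    \sum_(1 <= i < n.+1) (gaps_between n a i)%:Z
    + (1 + x_first t + x_last t)
      * (card_set (a `&` [set b | period n + n%:Z < b]))%:Z
    + \sum_(b \in a `&` [set b | period n + 1 <= b <= period n + n%:Z])
        (b - period n + x_first t).
Proof.
have [m nE] : exists m, n = m.+2 by exists n.-2; move: hn; case: (t) => /=; lia.
subst n; have [wA _] := hw; have [wP _] := wA.
rewrite (coxeter_length_window hn wP (affine_admissible wA)).
exact: window_length_beads wP ha (min_coset_rep_ascent hn hw).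
Qed.
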